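(* Let $\mathcal S$ be an operator system and suppose that the set $\mathcal S^+_{\|\cdot\|\le 1}$ of positive elements of norm at most $1$ in $\mathcal S$ is indexed by a set $I$. Then $\mathcal S$ is an operator system quotient of $\mathfrak C_I$, i.e. there is a complete order quotient map $\Phi:\mathfrak C_I\to\mathcal S$. Furthermore, $\Phi$ can be chosen so that its kernel is completely order proximinal and, for every $k\in\mathbb N$, every positive element $x\in M_k(\mathcal S)$ can be lifted (along $\Phi_k$) to a positive element $\tilde x\in M_k(\mathfrak C_I)$ with $\|\tilde x\|\le k^2\|x\|$.
   Context: Operator systems are abstract (Choi–Effros) operator systems: matrix ordered $*$-vector spaces with an Archimedean matrix order unit; they are not assumed complete. Norms on $M_n(\mathcal S)$ are those induced by the operator system structure. For a linear map $\varphi:V\to W$, $\varphi_n:M_n(V)\to M_n(W)$ is its entrywise amplification. ''$\mathcal S^+_{\|\cdot\|\le1}$ is indexed by $I$'' means $\mathcal S^+_{\|\cdot\|\le1}=\{x_\iota:\iota\in I\}$. Complete order quotient map: a unital completely positive surjection $\varphi:\mathcal S\to\mathcal T$ of operator systems such that for all $n$, all $Q\in M_n(\mathcal T)^+$ and all $\varepsilon>0$ there is $P\in M_n(\mathcal S)^+$ with $\varphi_n(P)=Q+\varepsilon I_n\otimes 1_{\mathcal T}$. $\mathcal T$ is an operator system quotient of $\mathcal S$ if there is a complete order quotient map $\mathcal S\to\mathcal T$. A kernel $\mathcal J$ in $\mathcal S$ is the kernel of a unital completely positive map from $\mathcal S$ to an operator system. The quotient operator system $\mathcal S/\mathcal J$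 has cones $M_n(\mathcal S/\mathcal J)^+=\{[x_{i,j}+\mathcal J]:\forall\varepsilon>0\ \exists k_{i,j}\in\mathcal J,\ \varepsilon I_n\otimes1_{\mathcal S}+[x_{i,j}+k_{i,j}]\in M_n(\mathcal S)^+\}$. The kernel $\mathcal J$ is completely order proximinal if for all $n$, $M_n(\mathcal S/\mathcal J)^+=\{[x_{i,j}+\mathcal J]:\exists k_{i,j}\in\mathcal J,\ [x_{i,j}+k_{i,j}]\in M_n(\mathcal S)^+\}$. Coproduct: for a family $\{\mathcal S_\lambda\}_{\lambda\in\Lambda}$ of operator systems, $\oplus_1\{\mathcal S_\lambda:\lambda\in\Lambda\}$ is the algebraic direct sum (finitely supported families) modulo the subspace spanned by the differences $n_{\lambda_1}-n_{\lambda_2}$, where $n_\lambda$ is $1_{\mathcal S_\lambda}$ in coordinate $\lambda$ and $0$ elsewhere (so all units are identified). Elements of $M_n$ of it are written $\sum_{\lambda\in F}x_\lambda$ with $F\subset\Lambda$ finite and $x_\lambda\in M_n(\mathcal S_\lambda)$; the involution is $(\sum x_\lambda)^*=\sum x_\lambda^*$, and $\sum_{\lambda\in F}x_\lambda\ge0$ iff $\sum_{\lambda\in F}\omega_\lambda(x_\lambda)\ge0$ for every family of states $\omega_\lambda$ on $M_n(\mathcal S_\lambda)$, $\lambda\in F$, whose restrictions to $M_n\cong M_n\otimes\mathbb C1_{\mathcal S_\lambda}$ all coincide. The order unit is the common class of the $n_\lambda$. The operator system $\mathfrak C_I$: let $I$ be a (nonempty) index set and $\{I_k\}_{k\in\mathbb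 N}$ a sequence of index sets, each of the same cardinality as $I$. For $\iota_k\in I_k$ let $\mathfrak C_{\iota_k}$ be the operator subsystem of (a copy, labelled $\iota_k$, of) $M_k(C([0,1]))$ spanned by $e_{ij}\otimes1$ and $e_{ij}\otimes t$, $1\le i,j\le k$, where $1,t\in C([0,1])$ are the constant function and the coordinate function. Then $\mathfrak C_I:=\oplus_1\{\mathfrak C_{\iota_k}:k\in\mathbb N,\iota_k\in I_k\}$. *)

(* Defs.v *)
From HB Require Import structures.
From mathcomp Require Import all_boot all_order all_algebra finmap.
From mathcomp Require Import generic_quotient ring_quotient complex.
From mathcomp Require Import all_classical all_reals all_analysis.

Set Implicit Arguments.
Unset Strict Implicit.
Unset Printing Implicit Defensive.

Import Order.TTheory GRing.Theory Num.Theory.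
Import numFieldNormedType.Exports.

Local Open Scope classical_set_scope.
Local Open Scope complex_scope.
Local Open Scope ring_scope.

Section Subspaces.
Variables (K : pzRingType).

Definition kernel (V W : lmodType K) (f : {linear V -> W}) : {pred V} :=
  fun v => f v == 0.

Lemma kernel_closed (V W : lmodType K) (f : {linear V -> W}) :
  submod_closed (kernel f).
Proof.
split=> [|a u v]; rewrite !unfold_in /kernel ?linear0// linearP.
by move=> /eqP -> /eqP ->; rewrite scaler0 addr0.
Qed.

Definition span (V : lmodType K) (A : set V) : {pred V} :=
  fun v => `[< forall J : {pred V}, submod_closed J -> A `<=` [set` J] ->
                 v \in J >].

Lemma span_closed (V : lmodType K) (A : set V) : submod_closed (span A).
Proof.
split=> [|a u v]; rewrite !unfold_in; first by apply/asboolP => J [].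
move=> /asboolP uA /asboolP vA; apply/asboolP => J JJ AJ.
by apply: JJ.2; [exact: uA|exact: vA].
Qed.

Lemma mem_span (V : lmodType K) (A : set V) v : A v -> v \in span A.
Proof. by move=> Av; rewrite unfold_in; apply/asboolP => J _; apply. Qed.

Lemma span_ind (V : lmodType K) (A : set V) (J : {pred V}) :
  submod_closed J -> A `<=` [set` J] -> {subset span A <= J}.
Proof. by move=> JJ AJ v; rewrite unfold_in => /asboolP; apply. Qed.

End Subspaces.

HB.instance Definition _ (K : pzRingType) (V W : lmodType K)
    (f : {linear V -> W}) :=
  GRing.isSubmodClosed.Build K V (kernel f) (kernel_closed f).
HB.instance Definition _ (K : pzRingType) (V : lmodType K) (A : set V) :=
  GRing.isSubmodClosed.Build K V (span A) (span_closed A).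

Section LinearQuotient.
Variables (K : pzRingType) (V : lmodType K) (J : submodClosed V).

(* [J] again, now as a subgroup: [submodClosed] does not inherit from
   [zmodClosed], on which the library's quotient of abelian groups is based. *)
Definition subgroup_of : {pred V} := J.
Fact subgroup_of_closed : zmod_closed subgroup_of.
Proof.
split=> [|u v uJ vJ]; first exact: (rpred0 J).
by rewrite -scaleN1r; apply: (@rpredD _ J) => //; exact: (@rpredZ _ _ J).
Qed.
HB.instance Definition _ :=
  GRing.isZmodClosed.Build V subgroup_of subgroup_of_closed.

Definition quot := Quotient.quot subgroup_of.
HB.instance Definition _ := GRing.Zmodule.on quot.

Definition class (v : V) : quot := (\pi_(Quotient.quot subgroup_of) v)%qT.
Definition class_repr (q : quot) : V := repr (q : Quotient.quot subgroup_of).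

Lemma class_reprK : cancel class_repr class.
Proof. by move=> q; rewrite /class /class_repr reprK. Qed.

Lemma classD u v : class (u + v) = class u + class v.
Proof. exact: (Quotient.pi_add subgroup_of u v). Qed.

Lemma class_eq u v : (class u == class v) = (u - v \in J).
Proof. by rewrite /class -Quotient.idealrBE. Qed.

Definition quot_scale (a : K) (q : quot) : quot := class (a *: class_repr q).

Lemma quot_scaleE a v : quot_scale a (class v) = class (a *: v).
Proof.
apply/eqP; rewrite class_eq -scalerBr; apply: rpredZ; rewrite -class_eq.
by rewrite class_reprK.
Qed.

Let quot_scaleA a b v : quot_scale a (quot_scale b v) = quot_scale (a * b) v.
Proof. by rewrite -[v]class_reprK !quot_scaleE scalerA. Qed.
Let quot_scale1 : left_id 1 quot_scale.
Proof. by move=> v; rewrite -[v]class_reprK quot_scaleE scale1r. Qed.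
Let quot_scaleDr : right_distributive quot_scale +%R.
Proof.
move=> a u v; rewrite -[u]class_reprK -[v]class_reprK.
by rewrite -classD !quot_scaleE scalerDr classD.
Qed.
Let quot_scaleDl v : {morph quot_scale^~ v : a b / a + b}.
Proof.
by move=> a b; rewrite -[v]class_reprK !quot_scaleE scalerDl classD.
Qed.
HB.instance Definition _ := GRing.Zmodule_isLmodule.Build K quot
  quot_scaleA quot_scale1 quot_scaleDr quot_scaleDl.

Lemma class_is_linear : linear class.
Proof. by move=> a u v; rewrite classD -quot_scaleE. Qed.
HB.instance Definition _ :=
  GRing.isLinear.Build K V quot _ class class_is_linear.

End LinearQuotient.
Arguments class {K V} J v.

(* A *-vector space with a selfadjoint unit and a set [mpos] of "positive"
   matrices at each level; the order axioms are in [operator_system] below.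
   Level [n = 0] is allowed, where there is only one matrix. *)
HB.mixin Record isMatOrdered (R : realType) V of GRing.Lmodule R[i] V := {
  star : V -> V;
  mpos : forall n, set 'M[V]_n;
  unit_elt : V;
  star_semilinear : forall (a : R[i]) (x y : V),
    star (a *: x + y) = a^* *: star x + star y;
  star_involutive : involutive star;
  star_unit : star unit_elt = unit_elt
}.
#[short(type="matOrdType")]
HB.structure Definition MatOrdered (R : realType) :=
  {V of GRing.Lmodule R[i] V & isMatOrdered R V}.
Arguments unit_elt {R} V : rename.
Arguments mpos {R V n} _ : rename.

Section StarTheory.
Variables (R : realType) (V : matOrdType R).
Implicit Types x y : V.

Lemma star0 : star (0 : V) = 0.
Proof.
have := star_semilinear (-1) (0 : V) 0.
by rewrite scaler0 addr0 rmorphN1 scaleN1r addNr.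
Qed.

Lemma starD x y : star (x + y) = star x + star y.
Proof. by rewrite -[x]scale1r star_semilinear rmorph1 !scale1r. Qed.

Lemma starZ (a : R[i]) x : star (a *: x) = a^* *: star x.
Proof. by rewrite -[_ *: x]addr0 star_semilinear star0 addr0. Qed.

Lemma starN x : star (- x) = - star x.
Proof. by rewrite -scaleN1r starZ rmorphN1 scaleN1r. Qed.

End StarTheory.

Section MatrixOps.
Variables (R : realType) (V : matOrdType R).

Definition starmx n (A : 'M[V]_n) : 'M[V]_n := \matrix_(i, j) star (A j i).

(* a (x) 1_V; in particular [tens1 r%:C%:M] is r I_n (x) 1_V *)
Definition tens1 n (a : 'M[R[i]]_n) : 'M[V]_n :=
  \matrix_(i, j) (a i j *: unit_elt V).

(* X^* A X *)
Definition congmx n m (X : 'M[R[i]]_(n, m)) (A : 'M[V]_n) : 'M[V]_m :=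
  \matrix_(i, j) \sum_(k < n) \sum_(l < n) (((X k i)^* * X l j) *: A k l).

Definition scale_mx n (a : R[i]) (A : 'M[V]_n) : 'M[V]_n :=
  map_mx ( *:%R a) A.

Definition opnorm n (A : 'M[V]_n) : R :=
  inf [set r : R | 0 <= r /\
    mpos (block_mx (tens1 r%:C%:M) A (starmx A) (tens1 r%:C%:M))].

Definition pos_elt (x : V) : Prop := mpos (const_mx x : 'M[V]_1).
Definition opnorm_elt (x : V) : R := opnorm (const_mx x : 'M[V]_1).

Record operator_system : Prop := OperatorSystem {
  mpos_selfadjoint : forall n (A : 'M[V]_n), mpos A -> starmx A = A;
  mpos0 : forall n, mpos (0 : 'M[V]_n);
  mposD : forall n (A B : 'M[V]_n), mpos A -> mpos B -> mpos (A + B);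
  mposZ : forall n (r : R) (A : 'M[V]_n),
    0 <= r -> mpos A -> mpos (scale_mx r%:C A);
  mpos_proper : forall n (A : 'M[V]_n), mpos A -> mpos (- A) -> A = 0;
  mpos_cong : forall n m (X : 'M[R[i]]_(n, m)) (A : 'M[V]_n),
    mpos A -> mpos (congmx X A);
  matrix_order_unit : forall n (A : 'M[V]_n), starmx A = A ->
    exists2 r : R, 0 < r & mpos (tens1 r%:C%:M - A);
  mpos_archimedean : forall n (A : 'M[V]_n),
    (forall r : R, 0 < r -> mpos (tens1 r%:C%:M + A)) -> mpos A
}.

End MatrixOps.
Arguments operator_system {R} V.
Arguments tens1 {R} V {n} a.

Section Maps.
Variables (R : realType) (V W : matOrdType R) (f : {linear V -> W}).

Definition completely_positive : Prop :=
  forall n (A : 'M[V]_n), mpos A -> mpos (map_mx f A).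

Definition unital_completely_positive : Prop :=
  f (unit_elt V) = unit_elt W /\ completely_positive.

Definition complete_order_quotient_map : Prop :=
  [/\ operator_system V, operator_system W,
      unital_completely_positive,
      (forall w, exists v, f v = w) &
      forall n (Q : 'M[W]_n) (eps : R), mpos Q -> 0 < eps ->
        exists2 P : 'M[V]_n, mpos P & map_mx f P = Q + tens1 W eps%:C%:M].

End Maps.

Section CompletelyOrderProximinal.
Variables (R : realType) (V : matOrdType R) (J : submodClosed V).

Definition quot_mpos n : set 'M[quot J]_n :=
  [set Q | exists2 x : 'M[V]_n, Q = map_mx (class J) x &
    forall eps : R, 0 < eps -> exists2 k : 'M[V]_n,
      (forall i j, k i j \in J) & mpos (tens1 V eps%:C%:M + (x + k))].

Definition completely_order_proximinal : Prop :=
  forall n, @quot_mpos n =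
    [set Q | exists2 x : 'M[V]_n, Q = map_mx (class J) x &
      exists2 k : 'M[V]_n, (forall i j, k i j \in J) & mpos (x + k)].

End CompletelyOrderProximinal.

Definition mxsys (R : realType) (V : matOrdType R) (k : nat) := 'M[V]_k.

Section MatrixSystem.
Variables (R : realType) (V : matOrdType R) (k : nat).
HB.instance Definition _ := GRing.Zmodule.on (mxsys V k).

Let mxsys_scale (a : R[i]) (A : mxsys V k) : mxsys V k := scale_mx a A.
Let mxsys_scaleA a b v :
  mxsys_scale a (mxsys_scale b v) = mxsys_scale (a * b) v.
Proof. by apply/matrixP => i j; rewrite !mxE scalerA. Qed.
Let mxsys_scale1 : left_id 1 mxsys_scale.
Proof. by move=> v; apply/matrixP => i j; rewrite !mxE scale1r. Qed.
Let mxsys_scaleDr : right_distributive mxsys_scale +%R.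
Proof. by move=> a u v; apply/matrixP => i j; rewrite !mxE scalerDr. Qed.
Let mxsys_scaleDl v : {morph mxsys_scale^~ v : a b / a + b}.
Proof. by move=> a b; apply/matrixP => i j; rewrite !mxE scalerDl. Qed.
HB.instance Definition _ := GRing.Zmodule_isLmodule.Build R[i] (mxsys V k)
  mxsys_scaleA mxsys_scale1 mxsys_scaleDr mxsys_scaleDl.

(* M_n(M_k(V)) = M_nk(V), by erasing the inner brackets *)
Definition mxsys_mpos n : set 'M[mxsys V k]_n :=
  [set A | mpos (\mxblock_(i < n, j < n) (A i j : 'M[V]_k))].

Let mxsys_star (A : mxsys V k) : mxsys V k := starmx A.
Let mxsys_star_semilinear (a : R[i]) (A B : mxsys V k) :
  mxsys_star (a *: A + B) = a^* *: mxsys_star A + mxsys_star B.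
Proof. by apply/matrixP => i j; rewrite !mxE star_semilinear. Qed.
Let mxsys_starK : involutive mxsys_star.
Proof. by move=> A; apply/matrixP => i j; rewrite !mxE star_involutive. Qed.
Let mxsys_star_unit : mxsys_star (tens1 V 1%:M) = tens1 V 1%:M.
Proof.
apply/matrixP => i j; rewrite !mxE starZ star_unit eq_sym.
by case: eqP => _; rewrite ?rmorph1 ?rmorph0.
Qed.
HB.instance Definition _ := isMatOrdered.Build R (mxsys V k)
  mxsys_mpos mxsys_star_semilinear mxsys_starK mxsys_star_unit.

End MatrixSystem.

HB.mixin Record isStarUnital (R : realType) (V : matOrdType R)
    (J : V -> bool) := {
  subsys_star : {in J, forall v, star v \in J};
  subsys_unit : unit_elt V \in J
}.
#[short(type="subsystem")]
HB.structure Definition Subsystem (R : realType) (V : matOrdType R) :=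
  {J of @GRing.SubmodClosed R[i] V J & isStarUnital R V J}.

Section OperatorSubsystem.
Variables (R : realType) (V : matOrdType R) (J : subsystem V).

Definition subsys := {v : V | v \in J}.
HB.instance Definition _ := [isSub of subsys for @sval V _].
HB.instance Definition _ := [Choice of subsys by <:].
HB.instance Definition _ := [SubChoice_isSubLmodule of subsys by <:].

Definition subsys_starT (v : subsys) : subsys :=
  exist _ (star (val v)) (subsys_star _ (valP v)).

Definition subsys_mpos n : set 'M[subsys]_n :=
  [set A | mpos (map_mx val A)].

Let subsys_one : subsys := exist _ (unit_elt V) subsys_unit.
Let subsys_star_semilinear (a : R[i]) (x y : subsys) :
  subsys_starT (a *: x + y) = a^* *: subsys_starT x + subsys_starT y.
Proof. by apply/val_inj; exact: star_semilinear. Qed.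
Let subsys_starK : involutive subsys_starT.
Proof. by move=> x; apply/val_inj; exact: star_involutive. Qed.
Let subsys_star_unit : subsys_starT subsys_one = subsys_one.
Proof. by apply/val_inj; exact: star_unit. Qed.
HB.instance Definition _ := isMatOrdered.Build R subsys
  subsys_mpos subsys_star_semilinear subsys_starK subsys_star_unit.

End OperatorSubsystem.

Section ContinuousFunctions.
Variables (R : realType) (X : topologicalType).

Definition continuous_pred : {pred X -> R[i]^o} :=
  fun f => `[< continuous f >].

Fact continuous_pred_closed : submod_closed continuous_pred.
Proof.
split=> [|a f g].
  by rewrite unfold_in; apply/asboolP => x; exact: cvg_cst.
rewrite !unfold_in => /asboolP cf /asboolP cg; apply/asboolP => x.
by apply: cvgD; [apply: cvgZr; exact: cf|exact: cg].
Qed.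
HB.instance Definition _ := GRing.isSubmodClosed.Build R[i] (X -> R[i]^o)
  continuous_pred continuous_pred_closed.

Definition contfun := {f : X -> R[i]^o | f \in continuous_pred}.
HB.instance Definition _ := [isSub of contfun for @sval _ _].
HB.instance Definition _ := [Choice of contfun by <:].
HB.instance Definition _ := [SubChoice_isSubLmodule of contfun by <:].

Lemma conjc_continuous : continuous (fun z : R[i]^o => z^* : R[i]^o).
Proof.
move=> z; apply/(@cvgrPdist_lt _ R[i]^o _ (nbhs z) (nbhs_filter z)) => e e0.
by exists e => //= y; rewrite /= -rmorphB/= normcJ.
Qed.

Fact contfun_star_subproof (f : contfun) :
  (fun x => (val f x)^* : R[i]^o) \in continuous_pred.
Proof.
rewrite unfold_in; apply/asboolP => x.
have /asboolP cf := valP f.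
by apply: continuous_comp; [exact: cf|exact: conjc_continuous].
Qed.

Fact contfun_one_subproof : (fun=> 1 : R[i]^o) \in continuous_pred.
Proof. by rewrite unfold_in; apply/asboolP => x; exact: cvg_cst. Qed.

Definition contfun_star (f : contfun) : contfun :=
  exist (fun g => g \in continuous_pred) _ (contfun_star_subproof f).
Definition contfun_one : contfun :=
  exist (fun g => g \in continuous_pred) _ contfun_one_subproof.

Definition psd n (A : 'M[R[i]]_n) : Prop :=
  forall v : 'cV[R[i]]_n, 0 <= ((map_mx Num.conj v)^T *m A *m v) 0 0.

Definition contfun_mpos n : set 'M[contfun]_n :=
  [set A | forall x : X, psd (\matrix_(i, j) val (A i j) x)].

Let contfun_star_semilinear (a : R[i]) (f g : contfun) :
  contfun_star (a *: f + g) = a^* *: contfun_star f + contfun_star g.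
Proof.
by apply/val_inj/funext => x /=; rewrite rmorphD rmorphM.
Qed.
Let contfun_starK : involutive contfun_star.
Proof. by move=> f; apply/val_inj/funext => x /=; exact: conjcK. Qed.
Let contfun_star_one : contfun_star contfun_one = contfun_one.
Proof. by apply/val_inj/funext => x /=; exact: rmorph1. Qed.
HB.instance Definition _ := isMatOrdered.Build R contfun
  contfun_mpos contfun_star_semilinear contfun_starK contfun_star_one.

End ContinuousFunctions.

Section FrakC.
Variable R : realType.

Definition unit_interval := set_type `[(0 : R), 1]%classic.
HB.instance Definition _ := Topological.on unit_interval.

Definition C01 := contfun R unit_interval.
HB.instance Definition _ := MatOrdered.on C01.

Lemma real_complex_continuous : continuous (fun x : R => x%:C : R[i]^o).
Proof.
move=> x; apply/(@cvgrPdist_lt _ R[i]^o _ (nbhs x) (nbhs_filter x)) => e e0.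
have [r r0 er] : exists2 r : R, 0 < r & e = r%:C.
  case: e e0 => a b; rewrite ltcE/= => /andP[/eqP b0 a0].
  by exists a; rewrite ?b0.
exists r => //= y /=; rewrite -rmorphB/= er normc_def/=.
by rewrite expr0n addr0 sqrtr_sqr ltcR.
Qed.

Fact coordinate_subproof :
  (fun t : unit_interval => (val t)%:C : R[i]^o)
    \in @continuous_pred R unit_interval.
Proof.
rewrite unfold_in; apply/asboolP => x.
apply: (@continuous_comp unit_interval R R[i]^o) => //.
  exact: initial_continuous.
exact: real_complex_continuous.
Qed.

Definition coordinate : C01 :=
  exist (fun g => g \in @continuous_pred R unit_interval) _
    coordinate_subproof.

Variable k : nat.

Definition elem_tens (i j : 'I_k) (f : C01) : mxsys C01 k :=
  \matrix_(a, b) (if (a == i) && (b == j) then f else 0).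

Definition frakC_gen : set (mxsys C01 k) :=
  [set F | exists i j, F = elem_tens i j (unit_elt C01)] `|`
  [set F | exists i j, F = elem_tens i j coordinate].

Lemma star_elem_tens i j f : star (elem_tens i j f) = elem_tens j i (star f).
Proof.
apply/matrixP => a b; rewrite !mxE andbC; case: ifP => // _.
exact: star0.
Qed.

Fact frakC_star : {in span frakC_gen, forall F, star F \in span frakC_gen}.
Proof.
apply: (span_ind (J := fun F => star F \in span frakC_gen)).
  split=> [|a F G FC GC].
    rewrite -[_ \in _]/(star (0 : mxsys C01 k) \in span frakC_gen).
    by rewrite star0; exact: (rpred0 (span frakC_gen)).
  rewrite -[_ \in _]/(star (a *: F + G) \in span frakC_gen).
  rewrite star_semilinear.
  by apply: (@rpredD _ (span frakC_gen)) => //;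
    apply: (@rpredZ _ _ (span frakC_gen)).
move=> F FG; rewrite /= -[_ \in _]/(star F \in span frakC_gen).
case: FG => -[i [j ->]]; rewrite star_elem_tens; apply: mem_span;
  [left|right]; exists j, i; congr elem_tens.
  exact: star_unit.
by apply/val_inj/funext => x /=; exact: conjc_real.
Qed.

Fact frakC_unit : unit_elt (mxsys C01 k) \in span frakC_gen.
Proof.
suff -> : unit_elt (mxsys C01 k) =
    \sum_(i < k) elem_tens i i (unit_elt C01).
  apply: (@rpred_sum _ (span frakC_gen)) => i _.
  by apply: mem_span; left; exists i, i.
apply/matrixP => a b; rewrite summxE !mxE.
under eq_bigr do rewrite mxE.
case: eqVneq => [->|ab].
  rewrite (bigD1 b)//= !eqxx/= big1 ?addr0 ?scale1r// => i /negPf.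
  by rewrite eq_sym => ->.
rewrite scale0r big1// => i _; case: ifP => // /andP[/eqP ai /eqP bi].
by rewrite ai bi eqxx in ab.
Qed.

HB.instance Definition _ :=
  isStarUnital.Build R (mxsys C01 k) (span frakC_gen) frakC_star frakC_unit.

(* the operator subsystem of M_k(C([0,1])) spanned by the e_ij (x) 1 and the
   e_ij (x) t *)
Definition frakC := subsys (span frakC_gen : subsystem (mxsys C01 k)).
HB.instance Definition _ := MatOrdered.on frakC.

End FrakC.

(* a state of the operator system M_n(V) *)
Definition mx_state (R : realType) (V : matOrdType R) n
    (w : {scalar mxsys V n}) : Prop :=
  w (tens1 V 1%:M) = 1 /\ forall A : 'M[V]_n, mpos A -> 0 <= w A.

Section DirectSum.
Variables (K : pzRingType) (L : choiceType) (V : L -> lmodType K).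

Definition dprod := forall l, V l.
HB.instance Definition _ := gen_eqMixin dprod.
HB.instance Definition _ := gen_choiceMixin dprod.

Let dprod_add (x y : dprod) : dprod := fun l => x l + y l.
Let dprod_opp (x : dprod) : dprod := fun l => - x l.
Let dprod_zero : dprod := fun=> 0.
Let dprod_scale (a : K) (x : dprod) : dprod := fun l => a *: x l.

Let dprod_addA : associative dprod_add.
Proof. by move=> x y z; apply/functional_extensionality_dep => l;
  exact: addrA. Qed.
Let dprod_addC : commutative dprod_add.
Proof. by move=> x y; apply/functional_extensionality_dep => l;
  exact: addrC. Qed.
Let dprod_add0 : left_id dprod_zero dprod_add.
Proof. by move=> x; apply/functional_extensionality_dep => l;
  exact: add0r. Qed.
Let dprod_addN : left_inverse dprod_zero dprod_opp dprod_add.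
Proof. by move=> x; apply/functional_extensionality_dep => l;
  exact: addNr. Qed.
HB.instance Definition _ := GRing.isZmodule.Build dprod
  dprod_addA dprod_addC dprod_add0 dprod_addN.

Let dprod_scaleA a b v :
  dprod_scale a (dprod_scale b v) = dprod_scale (a * b) v.
Proof. by apply/functional_extensionality_dep => l;
  exact: scalerA. Qed.
Let dprod_scale1 : left_id 1 dprod_scale.
Proof. by move=> x; apply/functional_extensionality_dep => l;
  exact: scale1r. Qed.
Let dprod_scaleDr : right_distributive dprod_scale +%R.
Proof. by move=> *; apply/functional_extensionality_dep => l;
  exact: scalerDr. Qed.
Let dprod_scaleDl v : {morph dprod_scale^~ v : a b / a + b}.
Proof. by move=> *; apply/functional_extensionality_dep => l;
  exact: scalerDl. Qed.
HB.instance Definition _ := GRing.Zmodule_isLmodule.Build K dprod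
  dprod_scaleA dprod_scale1 dprod_scaleDr dprod_scaleDl.

Definition finitely_supported : {pred dprod} :=
  fun x => `[< finite_set [set l | x l <> 0] >].

Fact finitely_supported_closed : submod_closed finitely_supported.
Proof.
split=> [|a x y]; rewrite !unfold_in.
  by apply/asboolP; apply: sub_finite_set (finite_set0 _) => l /=.
move=> /asboolP fx /asboolP fy; apply/asboolP.
have fxy : finite_set ([set l | x l <> 0] `|` [set l | y l <> 0]).
  by rewrite finite_setU.
apply: sub_finite_set fxy => l /= xyl.
have [xl|] := pselect (x l = 0); last by left.
right=> yl; apply: xyl.
by rewrite -[LHS]/(a *: x l + y l) xl yl scaler0 addr0.
Qed.
HB.instance Definition _ := GRing.isSubmodClosed.Build K dprod
  finitely_supported finitely_supported_closed.

Definition dsum := {x : dprod | x \in finitely_supported}.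
HB.instance Definition _ := [isSub of dsum for @sval _ _].
HB.instance Definition _ := [Choice of dsum by <:].
HB.instance Definition _ := [SubChoice_isSubLmodule of dsum by <:].

Fact dinj_subproof l (v : V l) :
  (dfwith (0 : dprod) l v : dprod) \in finitely_supported.
Proof.
rewrite unfold_in; apply/asboolP.
apply: sub_finite_set (finite_set1 l) => m /=.
by case: dfwithP => // j _; case.
Qed.

(* [v] in coordinate [l] and [0] elsewhere *)
Definition dinj l (v : V l) : dsum :=
  exist (fun x => x \in finitely_supported) _ (dinj_subproof v).

End DirectSum.

Section Coproduct.
Variables (R : realType) (L : choiceType) (V : L -> matOrdType R).

Definition unit_diff : set (dsum V) :=
  [set d | exists l m, d = dinj (unit_elt (V l)) - dinj (unit_elt (V m))].

Definition oplus1 := quot (span unit_diff).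
HB.instance Definition _ := GRing.Lmodule.on oplus1.

Definition oplus1_inj l (v : V l) : oplus1 := class (span unit_diff) (dinj v).

Let dsum_star_subproof (x : dsum V) :
  ((fun l => star (val x l)) : dprod V) \in @finitely_supported _ _ V.
Proof.
have /asboolP fx := valP x; rewrite unfold_in; apply/asboolP.
by apply: sub_finite_set fx => l /= xl x0; apply: xl; rewrite x0 star0.
Qed.

Definition dsum_star (x : dsum V) : dsum V :=
  exist (fun x => x \in @finitely_supported _ _ V) _ (dsum_star_subproof x).

Lemma dsum_star_semilinear (a : R[i]) (x y : dsum V) :
  dsum_star (a *: x + y) = a^* *: dsum_star x + dsum_star y.
Proof.
by apply/val_inj/functional_extensionality_dep => l; exact: star_semilinear.
Qed.

Lemma dsum_star_inj l (v : V l) : dsum_star (dinj v) = dinj (star v).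
Proof.
apply/val_inj/functional_extensionality_dep => m /=.
have [<-|lm] := eqVneq l m; first by rewrite !dfwithin.
by rewrite !dfwithout// star0.
Qed.

Lemma dsum_star_span x :
  x \in span unit_diff -> dsum_star x \in span unit_diff.
Proof.
move: x; apply: (span_ind (J := fun x => dsum_star x \in span unit_diff)).
  split=> [|a x y xC yC].
    rewrite -[_ \in _]/(dsum_star 0 \in span unit_diff).
    suff -> : dsum_star 0 = 0 by exact: (rpred0 (span unit_diff)).
    by apply/val_inj/functional_extensionality_dep => l; exact: star0.
  rewrite -[_ \in _]/(dsum_star (a *: x + y) \in span unit_diff).
  rewrite dsum_star_semilinear.
  by apply: (@rpredD _ (span unit_diff)) => //;
    apply: (@rpredZ _ _ (span unit_diff)).
move=> _ [l [m ->]]; rewrite /= -[_ \in _]/(dsum_star _ \in span unit_diff).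
apply: mem_span; exists l, m; rewrite addrC -scaleN1r dsum_star_semilinear.
by rewrite !dsum_star_inj !star_unit rmorphN1 scaleN1r addrC.
Qed.

Definition oplus1_star (q : oplus1) : oplus1 :=
  class (span unit_diff) (dsum_star (class_repr q)).

Lemma oplus1_starE x :
  oplus1_star (class (span unit_diff) x) = class (span unit_diff) (dsum_star x).
Proof.
apply/eqP; rewrite class_eq.
suff <- : dsum_star (class_repr (class (span unit_diff) x) - x) =
    dsum_star (class_repr (class (span unit_diff) x)) - dsum_star x.
  by apply: dsum_star_span; rewrite -class_eq class_reprK.
by apply/val_inj/functional_extensionality_dep => l;
  rewrite /= -[RHS]/(star _ - star _) -starN -starD.
Qed.

(* the common class of the units of the [V l] *)
Definition oplus1_unit : oplus1 :=
  xget 0 [set u | exists l, u = oplus1_inj (unit_elt (V l))].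

Lemma oplus1_unitE l : oplus1_unit = oplus1_inj (unit_elt (V l)).
Proof.
rewrite /oplus1_unit; case: xgetP => [u _ [m ->]|noL]; last first.
  by case: (noL (oplus1_inj (unit_elt (V l)))); exists l.
by apply/eqP; rewrite class_eq; apply: mem_span; exists m, l.
Qed.

(* The states [w l] are only relevant for [l \in F].  By extending states, the
   condition does not depend on the representation of [A] as a finite sum, as
   long as the [V l] are nonzero operator systems. *)
Definition oplus1_mpos n : set 'M[oplus1]_n :=
  [set A | exists (F : {fset L}) (x : forall l, 'M[V l]_n),
    A = \sum_(l <- F) map_mx (@oplus1_inj l) (x l) /\
    forall w : forall l, {scalar mxsys (V l) n},
      {in F, forall l, mx_state (w l)} ->
      {in F &, forall l m (a : 'M[R[i]]_n),
        w l (tens1 (V l) a) = w m (tens1 (V m) a)} ->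
      0 <= \sum_(l <- F) w l (x l)].

Let oplus1_star_semilinear (a : R[i]) (x y : oplus1) :
  oplus1_star (a *: x + y) = a^* *: oplus1_star x + oplus1_star y.
Proof.
rewrite -[x]class_reprK -[y]class_reprK -linearP !oplus1_starE.
by rewrite dsum_star_semilinear linearP.
Qed.
Let oplus1_starK : involutive oplus1_star.
Proof.
move=> x; rewrite -[x]class_reprK !oplus1_starE; congr class.
by apply/val_inj/functional_extensionality_dep => l; exact: star_involutive.
Qed.
Let oplus1_star_unit : oplus1_star oplus1_unit = oplus1_unit.
Proof.
rewrite {1}/oplus1_unit; case: xgetP => [u _ [l ->]|noL].
  by rewrite oplus1_starE dsum_star_inj star_unit (oplus1_unitE l).
rewrite /oplus1_unit; case: xgetP => [u _ /noL//|_].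
rewrite -(linear0 (class (span unit_diff))) oplus1_starE; congr class.
by apply/val_inj/functional_extensionality_dep => l; exact: star0.
Qed.
HB.instance Definition _ := isMatOrdered.Build R oplus1
  oplus1_mpos oplus1_star_semilinear oplus1_starK oplus1_star_unit.

End Coproduct.

(* [I k] indexes the copies of the system inside M_{k+1}(C([0,1])): the matrix
   sizes start at 1. *)
Definition frakC_coproduct (R : realType) (I : nat -> Type) :=
  oplus1 (fun l : {classic {k : nat & I k}} =>
            frakC R (projT1 l).+1 : matOrdType R).
HB.instance Definition _ (R : realType) (I : nat -> Type) :=
  MatOrdered.on (frakC_coproduct R I).

(* Main.v *)
From HB Require Import structures.
Require Import Defs.
From mathcomp Require Import all_boot all_order all_algebra finmap.
From mathcomp Require Import sesquilinear spectral complex ring lra.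
From mathcomp Require Import all_classical all_reals.

Set Implicit Arguments.
Unset Strict Implicit.
Unset Printing Implicit Defensive.

Import Order.TTheory GRing.Theory Num.Theory.

Local Open Scope classical_set_scope.
Local Open Scope complex_scope.
Local Open Scope ring_scope.

(** The system [frakC R k] consists of affine functions on [0, 1] with values in
    the [k x k] matrices.  By Choi's theorem, two positive matrices [P0], [P1]
    in [M_k(S)] define a completely positive map
    [F |-> sum_ab F(0)_ab P0_ab + F(1)_ab P1_ab] into [S], which is unital if the
    traces of [P0] and [P1] add up to [1] ([choi_map_cp], [choi_map_unit]).  For
    every positive [P] of trace at most [1] there is thus a unital completely
    positive map that sends [e_ab (x) t] to [P_ab]: take [P1 = P], and
    [P0] with the defect [1 - tr P] in a corner ([choi_ucp]).  The matrix
    [(e_ab (x) t)_ab] is positive and at most [k] ([coord_matrix_mpos],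
    [coord_matrix_le]).  If [y] is any nonzero positive element of [M_k(S)], then
    [y / (k |y|)] is such a [P], so [y] is the image of the positive element
    [k |y| (e_ab (x) t)_ab] of norm at most [k^2 |y|].  Let [Phi] be the map on
    the coproduct that is given on the copies of [frakC R k] by all these [P],
    for all [k].  All positive matrices over [S] lift exactly along [Phi],
    whence it is a complete order quotient map with a completely order
    proximinal kernel.

    Three points need proof.  The coproduct is an operator system
    ([oplus1_operator_system]), and a map out of it is completely positive as
    soon as it is so on each summand ([oplus1_map_cp]).  Both are reduced to
    the functionals on [M_n] of the coproduct that are positive on each summand
    ([oplus1_mposP]).  If the image of a positive matrix were not positive, a
    state of [M_n(S)] would separate it from the cone ([state_separation], a
    form of the Hahn-Banach theorem), and this state would pull back to such a
    functional.  Finally, the set [I], which indexes the positive contractions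
    of [S], must be large enough to index all [P].  If [S] is not trivial, then
    [I] is infinite, so that [I * I] injects into [I]
    ([infinite_square_injection]); since the positive contractions span [S], the
    set [I] maps onto [M_k(S)] ([matrix_indexing]). *)

(** * Positive semidefinite forms *)

Section PositiveForms.
Variables (C : numClosedFieldType) (T : finType).
Implicit Types (Q : T -> T -> C) (v : T -> C).

(** The quadratic form [v^* Q v] of a complex matrix [Q] with rows and columns
    indexed by the finite type [T]. *)
Definition qform Q v : C := \sum_p \sum_q (v p)^* * Q p q * v q.

(** Positive semidefiniteness. *)
Definition psdform Q : Prop := forall v, 0 <= qform Q v.

Lemma sum_delta (F : T -> C) a : \sum_q F q * (q == a)%:R = F a.
Proof.
rewrite (bigD1 a)//= eqxx mulr1 big1 ?addr0// => q /negPf ->.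
by rewrite mulr0.
Qed.

(** The form on a combination of two basis vectors, from which the entries of
    [Q] are recovered. *)
Lemma qform_pair Q a b (x y : C) :
  qform Q (fun p => x * (p == a)%:R + y * (p == b)%:R) =
  `|x| ^+ 2 * Q a a + x^* * y * Q a b + y^* * x * Q b a + `|y| ^+ 2 * Q b b.
Proof.
pose F p q := (x * (p == a)%:R + y * (p == b)%:R)^* * Q p q.
transitivity (\sum_p ((x * (x^* * Q p a) + y * (x^* * Q p b)) * (p == a)%:R +
                      (x * (y^* * Q p a) + y * (y^* * Q p b)) * (p == b)%:R)).
  apply: eq_bigr => p _.
  transitivity (\sum_q (F p q * x * (q == a)%:R + F p q * y * (q == b)%:R)).
    by apply: eq_bigr => q _; rewrite mulrDr !mulrA.
  rewrite big_split/= !sum_delta /F rmorphD !rmorphM/= !conjC_nat; ring.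
rewrite big_split/= !sum_delta !normCK; ring.
Qed.

Lemma psdform_diag Q a : psdform Q -> 0 <= Q a a.
Proof.
move=> /(_ (fun p => 1 * (p == a)%:R + 0 * (p == a)%:R)).
rewrite qform_pair normr1 expr1n mul1r normr0 expr0n/=.
by rewrite !(mul0r, mulr0) conjC0 !(mul0r, addr0).
Qed.

Lemma psdform_herm Q a b : psdform Q -> (Q a b)^* = Q b a.
Proof.
move=> Qp; have := psdform_diag a Qp; have := psdform_diag b Qp.
have := Qp (fun p => 1 * (p == a)%:R + 1 * (p == b)%:R).
have := Qp (fun p => 1 * (p == a)%:R + 'i * (p == b)%:R).
rewrite !qform_pair normCi normr1 !expr1n conjC1 conjCi !mul1r !mulr1.
set z := Q a b; set w := Q b a.
move=> /ger0_real/CrealP e1 /ger0_real/CrealP e2.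
move=> /ger0_real/CrealP eb /ger0_real/CrealP ea.
move: e1 e2; rewrite !rmorphD !rmorphM rmorphN/= conjCi ea eb => e1 e2.
have {}e2 : z^* + w^* = z + w.
  by apply: (addrI (Q a a)); apply: (addIr (Q b b)); rewrite !addrA.
have {}e1 : - 'i * z^* + 'i * w^* = 'i * z - 'i * w.
  apply: (addrI (Q a a)); apply: (addIr (Q b b)).
  by move: e1; rewrite !addrA opprK => ->; rewrite mulNr.
have {}e1 : w^* - z^* = z - w.
  by apply: (mulfI (neq0Ci C)); rewrite !mulrBr -e1 mulNr addrC.
have : 2 * z^* = 2 * w.
  have -> : 2 * z^* = z^* + w^* - (w^* - z^*) by ring.
  rewrite e1 e2; ring.
by apply: mulfI; rewrite pnatr_eq0.
Qed.

(** A positive semidefinite matrix is the Gram matrix of some vectors. *)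
Lemma psdform_gram Q : psdform Q ->
  exists (m : nat) (Y : 'I_m -> T -> C),
    forall p q, Q p q = \sum_r (Y r p)^* * Y r q.
Proof.
move=> Qp; pose A := \matrix_(i < #|T|, j < #|T|) Q (enum_val i) (enum_val j).
have /hermitian_normalmx/orthomx_spectralP : A \is hermsymmx.
  apply/is_hermitianmxP; rewrite expr0 scale1r; apply/matrixP => i j.
  by rewrite !mxE psdform_herm.
set P := spectralmx A; set sp := spectral_diag A => Asp.
have PU : P \is unitarymx := spectral_unitarymx A.
rewrite invmx_unitary// in Asp.
have AE p q : Q p q =
    \sum_r (P r (enum_rank p))^* * sp 0 r * P r (enum_rank q).
  rewrite -[p in LHS]enum_rankK -[q in LHS]enum_rankK.
  have := congr1 (fun M : 'M_ _ => M (enum_rank p) (enum_rank q)) Asp.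
  rewrite mul_mx_diag !mxE => ->.
  by apply: eq_bigr => r _; rewrite !mxE.
have sp_ge0 r : 0 <= sp 0 r.
  (* [sp 0 r] is the value of the form at the [r]-th eigenvector. *)
  have := Qp (fun p => (P r (enum_rank p))^*).
  rewrite /qform.
  pose g (i : 'I_#|T|) (j : 'I_#|T|) := P r i * A i j * (P r j)^*.
  rewrite (_ : \sum_p _ = \sum_i \sum_j g i j); last first.
    rewrite (reindex (@enum_val T predT))/=; last exact: onW_bij (enum_val_bij _).
    apply: eq_bigr => i _.
    rewrite (reindex (@enum_val T predT))/=; last exact: onW_bij (enum_val_bij _).
    by apply: eq_bigr => j _; rewrite /g mxE conjCK !enum_valK.
  suff -> : \sum_i \sum_j g i j = sp 0 r by [].
  have := congr1 (fun M => P *m M *m (map_mx Num.conj P^T)) Asp.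
  have PP := unitarymxP PU.
  rewrite /= !mulmxA PP mul1mx -[diag_mx sp *m P *m _]mulmxA PP mulmx1.
  move=> /(congr1 (fun M : 'M_ _ => M r r)); rewrite !mxE eqxx mulr1n => <-.
  rewrite exchange_big; apply: eq_bigr => j _; rewrite !mxE mulr_suml.
  by apply: eq_bigr => i _.
exists #|T|, (fun r p => sqrtC (sp 0 r) * P r (enum_rank p)) => p q.
rewrite AE; apply: eq_bigr => r _.
rewrite rmorphM/= (geC0_conj (_ : 0 <= sqrtC (sp 0 r))) ?sqrtC_ge0//.
rewrite -[in LHS](sqrtCK (sp 0 r)); ring.
Qed.

Lemma psdform_anti Q :
  psdform Q -> psdform (fun p q => - Q p q) -> forall p q, Q p q = 0.
Proof.
move=> Qp Qn p q; have [m [Y QE]] := psdform_gram Qp.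
have Q0 : Q p p = 0.
  by apply/eqP; rewrite eq_le psdform_diag// andbT -oppr_ge0; exact: psdform_diag Qn.
suff Y0 r : Y r p = 0.
  by rewrite QE big1// => r _; rewrite Y0 conjC0 mul0r.
apply/eqP; rewrite -normr_eq0 -sqrf_eq0 normCK mulrC.
have /eqP := Q0; rewrite QE psumr_eq0; last first.
  by move=> i _; rewrite mulrC -normCK exprn_ge0.
by move=> /allP/(_ r (mem_index_enum _)).
Qed.

Lemma qform_bound Q v (M : C) : 0 <= M -> (forall p q, `|Q p q| <= M) ->
  `|qform Q v| <= #|T|%:R * M * \sum_p `|v p| ^+ 2.
Proof.
move=> M0 QM; rewrite /qform; apply: le_trans (ler_norm_sum _ _ _) _.
have term p : `|\sum_q (v p)^* * Q p q * v q| <=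
    \sum_q M * ((`|v p| ^+ 2 + `|v q| ^+ 2) / 2).
  apply: le_trans (ler_norm_sum _ _ _) _; apply: ler_sum => q _.
  rewrite !normrM norm_conjC [X in X * _ <= _]mulrC -mulrA.
  apply: ler_pM => //; first exact: mulr_ge0.
  rewrite ler_pdivlMr// -subr_ge0 (_ : _ - _ = (`|v p| - `|v q|) ^+ 2).
    by rewrite -realEsqr rpredB// normr_real.
  ring.
apply: le_trans (ler_sum _ (fun p _ => term p)) _.
under eq_bigr => p _.
  rewrite -mulr_sumr -mulr_suml big_split/= sumr_const; over.
rewrite -mulr_sumr -mulr_suml big_split/= sumr_const.
rewrite le_eqVlt; apply/orP; left; apply/eqP.
rewrite (_ : \sum_i _ = #|T|%:R * \sum_i `|v i| ^+ 2); last first.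
  by rewrite mulr_sumr; apply: eq_bigr => i _; rewrite mulr_natl.
rewrite -[X in _ + X]mulr_natl; field.
by [].
Qed.

End PositiveForms.

(** In particular, compressions of positive semidefinite matrices are positive
    semidefinite. *)
Lemma psdform_comp (C : numClosedFieldType) (S T : finType) (h : S -> T)
    (Q : T -> T -> C) : psdform Q -> psdform (fun p q => Q (h p) (h q)).
Proof.
move=> /psdform_gram[m [Y QE]] v.
have -> : qform (fun p q => Q (h p) (h q)) v =
    \sum_r `|\sum_p Y r (h p) * v p| ^+ 2.
  under [RHS]eq_bigr => r _ do rewrite normCK mulrC rmorph_sum mulr_suml.
  rewrite exchange_big; apply: eq_bigr => p _.
  under [RHS]eq_bigr => r _ do rewrite mulr_sumr.
  rewrite exchange_big; apply: eq_bigr => q _.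
  rewrite QE mulr_sumr mulr_suml; apply: eq_bigr => r _.
  by rewrite rmorphM/=; ring.
by apply: sumr_ge0 => r _; exact: exprn_ge0.
Qed.

(** * Matrices over an operator system *)

(** Bundling a function that is known to be linear. *)
Lemma ex_scalar (K : pzRingType) (U : lmodType K) (f : U -> K) :
  scalar f -> exists g : {scalar U}, forall u, g u = f u.
Proof.
move=> sf.
pose g : {scalar U} := HB.pack f (GRing.isLinear.Build K U K *%R f sf).
by exists g.
Qed.

Lemma ex_linear (K : pzRingType) (U W : lmodType K) (f : U -> W) :
  linear f -> exists g : {linear U -> W}, forall u, g u = f u.
Proof.
move=> sf.
pose g : {linear U -> W} := HB.pack f (GRing.isLinear.Build K U W _ f sf).
by exists g.
Qed.

Lemma conj_real_complex (R : realType) (r : R) : (r%:C : R[i])^* = r%:C.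
Proof. exact: conjc_real. Qed.

Section MatrixAlgebra.
Variables (R : realType) (V : matOrdType R).
Local Notation C := R[i].

Lemma starmxD n (A B : 'M[V]_n) : starmx (A + B) = starmx A + starmx B.
Proof. by apply/matrixP => i j; rewrite !mxE starD. Qed.

Lemma starmxN n (A : 'M[V]_n) : starmx (- A) = - starmx A.
Proof. by apply/matrixP => i j; rewrite !mxE starN. Qed.

Lemma starmxB n (A B : 'M[V]_n) : starmx (A - B) = starmx A - starmx B.
Proof. by rewrite starmxD starmxN. Qed.

Lemma starmxK n : involutive (@starmx R V n).
Proof. by move=> A; apply/matrixP => i j; rewrite !mxE star_involutive. Qed.

Lemma starmxZ n (a : C) (A : 'M[V]_n) :
  starmx (scale_mx a A) = scale_mx a^* (starmx A).
Proof. by apply/matrixP => i j; rewrite !mxE starZ. Qed.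

Lemma starmx_tens1 n (a : 'M[C]_n) :
  starmx (tens1 V a) = tens1 V (map_mx Num.conj a^T).
Proof. by apply/matrixP => i j; rewrite !mxE starZ star_unit. Qed.

Lemma tens1D n (a b : 'M[C]_n) : tens1 V (a + b) = tens1 V a + tens1 V b.
Proof. by apply/matrixP => i j; rewrite !mxE scalerDl. Qed.

Lemma tens1N n (a : 'M[C]_n) : tens1 V (- a) = - tens1 V a.
Proof. by apply/matrixP => i j; rewrite !mxE scaleNr. Qed.

Lemma tens1_sum n (I : Type) (r : seq I) (P : pred I) (F : I -> 'M[C]_n) :
  tens1 V (\sum_(i <- r | P i) F i) = \sum_(i <- r | P i) tens1 V (F i).
Proof.
apply: (big_morph _ (@tens1D n)).
by apply/matrixP => i j; rewrite !mxE scale0r.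
Qed.

Lemma scale_tens1 n (a : C) (b : 'M[C]_n) :
  scale_mx a (tens1 V b) = tens1 V (a *: b).
Proof. by apply/matrixP => i j; rewrite !mxE scalerA. Qed.

Lemma tens1_scalar n (a : C) :
  tens1 V (a%:M : 'M_n) = scale_mx a (tens1 V 1%:M).
Proof. by rewrite scale_tens1 scalemx1. Qed.

Lemma congmx_is_linear n m (X : 'M[C]_(n, m)) (a : C) (A B : 'M[V]_n) :
  congmx X (scale_mx a A + B) = scale_mx a (congmx X A) + congmx X B.
Proof.
apply/matrixP => i j; rewrite !mxE scaler_sumr -big_split/=.
apply: eq_bigr => k _; rewrite scaler_sumr -big_split/=; apply: eq_bigr => l _.
by rewrite !mxE scalerDr !scalerA mulrC.
Qed.

Lemma congmx_tens1 n m (X : 'M[C]_(n, m)) (a : 'M[C]_n) :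
  congmx X (tens1 V a) = tens1 V ((map_mx Num.conj X)^T *m a *m X).
Proof.
apply/matrixP => i j; rewrite !mxE exchange_big scaler_suml/=.
apply: eq_bigr => l _; rewrite mxE mulr_suml scaler_suml.
by apply: eq_bigr => k _; rewrite !mxE scalerA -!mulrA [a k l * _]mulrC.
Qed.

End MatrixAlgebra.

Section OperatorSystemTheory.
Variables (R : realType) (V : matOrdType R).
Hypothesis OS : operator_system V.
Local Notation C := R[i].

Lemma mposZ_gt0 n (r : R) (A : 'M[V]_n) :
  0 < r -> mpos (scale_mx r%:C A) -> mpos A.
Proof.
move=> r0 /(mposZ OS (ltW (_ : 0 < r^-1))).
rewrite invr_gt0 => /(_ r0); suff -> : scale_mx r^-1%:C (scale_mx r%:C A) = A.
  by [].
by apply/matrixP => i j; rewrite !mxE scalerA -rmorphM/= mulVf ?gt_eqF// scale1r.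
Qed.

Lemma mpos_sum n (I : Type) (r : seq I) (P : pred I) (F : I -> 'M[V]_n) :
  (forall i, P i -> mpos (F i)) -> mpos (\sum_(i <- r | P i) F i).
Proof.
by move=> Fp; apply: big_ind => //; [exact: mpos0|exact: mposD].
Qed.

Lemma mpos_tens1_1 n : mpos (tens1 V 1%:M : 'M[V]_n).
Proof.
have [|r r0] := @matrix_order_unit _ _ OS n 0.
  by apply/matrixP => i j; rewrite !mxE star0.
by rewrite subr0 tens1_scalar; exact: mposZ_gt0.
Qed.

Lemma mpos_tens1_real n (r : R) : 0 <= r -> mpos (tens1 V r%:C%:M : 'M[V]_n).
Proof. by move=> r0; rewrite tens1_scalar; apply: mposZ => //; exact: mpos_tens1_1. Qed.

Lemma mpos_le n (r s : R) (A : 'M[V]_n) : r <= s ->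
  mpos (tens1 V r%:C%:M + A) -> mpos (tens1 V s%:C%:M + A).
Proof.
move=> rs rA; have -> : tens1 V s%:C%:M + A =
    tens1 V (s - r)%:C%:M + (tens1 V r%:C%:M + A).
  by rewrite addrA -tens1D rmorphB/= raddfB/= subrK.
by apply: mposD => //; apply: mpos_tens1_real; rewrite subr_ge0.
Qed.

Lemma order_unitP n (A : 'M[V]_n) : starmx A = A -> exists2 r : R, 0 < r &
  mpos (tens1 V r%:C%:M - A) /\ mpos (tens1 V r%:C%:M + A).
Proof.
move=> sA; have [r r0 rA] := matrix_order_unit OS sA.
have [|s s0] := @matrix_order_unit _ _ OS n (- A); first by rewrite starmxN sA.
rewrite opprK => sA'; exists (r + s); first exact: addr_gt0.
by split; [apply: mpos_le rA|apply: mpos_le sA']; rewrite ?lerDl ?lerDr ltW.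
Qed.

(** Scalar matrices inherit positivity from the complex numbers. *)
Lemma mpos_tens1_psd n (a : 'M[C]_n) :
  psdform (fun i j => a i j) -> mpos (tens1 V a).
Proof.
move=> /psdform_gram[m [Y aE]].
have -> : a = \sum_r ((map_mx Num.conj (\row_j Y r j))^T *m 1%:M *m \row_j Y r j).
  apply/matrixP => i j; rewrite aE summxE; apply: eq_bigr => r _.
  by rewrite mulmx1 mxE big_ord1 !mxE.
rewrite tens1_sum; apply: mpos_sum => r _.
by rewrite -congmx_tens1; apply: mpos_cong => //; exact: mpos_tens1_1.
Qed.

End OperatorSystemTheory.

Section PositiveFunctionals.
Variables (R : realType) (V : matOrdType R).
Local Notation C := R[i].

(** The linearity of a functional, for the operations of ['M[V]_n] rather than
    of its alias [mxsys V n]. *)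
Section Linearity.
Variables (n : nat) (w : {scalar mxsys V n}).
Implicit Types A B : 'M[V]_n.

Lemma mxfunZ a A : w (scale_mx a A) = a * w A.
Proof. exact: (linearZ_LR w a (A : mxsys V n)). Qed.

Lemma mxfunD A B : w (A + B) = w A + w B.
Proof. exact: (linearD w (A : mxsys V n)). Qed.

Lemma mxfunN A : w (- A) = - w A.
Proof. exact: (linearN w (A : mxsys V n)). Qed.

Lemma mxfunB A B : w (A - B) = w A - w B.
Proof. by rewrite mxfunD mxfunN. Qed.

Lemma mxfun0 : w (0 : 'M[V]_n) = 0.
Proof. exact: (linear0 w). Qed.

Lemma mxfun_sum (I : Type) (r : seq I) (P : pred I) (F : I -> 'M[V]_n) :
  w (\sum_(i <- r | P i) F i) = \sum_(i <- r | P i) w (F i).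
Proof. exact: (big_morph _ mxfunD mxfun0). Qed.

End Linearity.

(** A linear functional on [M_n(V)] that is nonnegative on the positive cone. *)
Definition positive_functional n (w : {scalar mxsys V n}) : Prop :=
  forall A : 'M[V]_n, mpos A -> 0 <= w A.

(** The cartesian decomposition of a matrix into selfadjoint parts. *)
Lemma cartesian n (A : mxsys V n) : exists H K : mxsys V n,
  [/\ starmx H = H, starmx K = K, A = H + 'i *: K &
      starmx A = H - 'i *: K :> mxsys V n].
Proof.
exists (2^-1 *: (A + starmx A)), ((2^-1 * - 'i) *: (A - starmx A)).
have c2 : (2^-1 : C)^* = 2^-1 by rewrite fmorphV/= conjC_nat.
have I2 : 'i * (2^-1 * - 'i) = 2^-1 :> C.
  by rewrite mulrCA mulrN -expr2 sqrCi opprK mulr1.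
have half (U : lmodType C) (x : U) : 2^-1 *: x + 2^-1 *: x = x.
  by rewrite -scalerDl -[X in (X + X) *: _]mul1r -splitr scale1r.
have halfD (U : lmodType C) (x y : U) : x = 2^-1 *: (x + y) + 2^-1 *: (x - y).
  by rewrite -scalerDr addrACA subrr addr0 scalerDr half.
have halfB (U : lmodType C) (x y : U) : y = 2^-1 *: (x + y) - 2^-1 *: (x - y).
  by rewrite -scalerBr opprB [x + y + _]addrC addrA subrK scalerDr half.
split.
- by rewrite [LHS]starmxZ c2 starmxD starmxK addrC.
- rewrite [LHS]starmxZ rmorphM rmorphN/= c2 conjCi opprK starmxB starmxK.
  by rewrite [in RHS]mulrN scaleNr -scalerN opprB.
- by rewrite scalerA I2; exact: halfD.
- by rewrite scalerA I2; exact: halfB.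
Qed.

Section Positive.
Hypothesis OS : operator_system V.
Variables (n : nat) (w : {scalar mxsys V n}).
Hypothesis wp : positive_functional w.

Lemma positive_functional_herm (A : mxsys V n) : w (starmx A) = (w A)^*.
Proof.
have w1 : w (tens1 V 1%:M) \is Num.real.
  by apply: ger0_real; apply: wp; exact: (mpos_tens1_1 OS).
have wreal H : starmx H = H -> (w H)^* = w H.
  move=> sH; have [r r0 [rH _]] := order_unitP OS sH.
  have /ger0_real wB := wp rH; move: wB.
  rewrite mxfunB tens1_scalar mxfunZ => wB.
  have -> : w H = r%:C * w (tens1 V 1%:M) -
      (r%:C * w (tens1 V 1%:M) - w H) by rewrite subKr.
  apply/CrealP; apply: rpredB => //; apply: rpredM => //.
  by apply: ger0_real; rewrite ler0c ltW.
have [H [K [sH sK -> ->]]] := cartesian A.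
rewrite linearB linearD linearZ/= rmorphD rmorphM/= conjCi !wreal// mulNr.
by [].
Qed.

(** Selfadjoint elements lie between two multiples of the unit. *)
Lemma positive_functional0 : w (tens1 V 1%:M) = 0 -> forall A, w A = 0.
Proof.
move=> w1 A.
have w0 H : starmx H = H -> w H = 0.
  move=> sH; have [r r0 [/wp + /wp]] := order_unitP OS sH.
  rewrite mxfunB mxfunD tens1_scalar mxfunZ w1 mulr0 sub0r add0r oppr_ge0.
  move=> h h'.
  by apply/eqP; rewrite eq_le h h'.
have [H [K [sH sK -> _]]] := cartesian A.
by rewrite linearD linearZ/= !w0// mulr0 addr0.
Qed.

End Positive.
End PositiveFunctionals.

(** * Separation of positive elements by states *)

Section ConeState.
Variables (R : realType) (E : lmodType R[i]) (e : E) (C0 : set E).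
Hypothesis C0D : forall u v, C0 u -> C0 v -> C0 (u + v).
Hypothesis C0Z : forall (r : R) v, 0 <= r -> C0 v -> C0 (r%:C *: v).
Hypothesis C0unit : forall v, exists2 r : R, 0 < r & C0 (r%:C *: e - v).
Hypothesis C0proper : ~ C0 (- e).

(** The convex cones that contain [C0] but not [- e]; the empty set is admitted
    so that the empty chain has an upper bound. *)
Let proper_cone (K : set E) := [/\ forall u v, K u -> K v -> K (u + v),
  forall (r : R) v, 0 < r -> K v -> K (r%:C *: v), ~ K (- e) &
  K = set0 \/ C0 `<=` K].

(** A maximal such cone contains one of any two opposite vectors. *)
Lemma maximal_cone : exists K : set E,
  [/\ forall u v, K u -> K v -> K (u + v),
      forall (r : R) v, 0 < r -> K v -> K (r%:C *: v), ~ K (- e),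
      C0 `<=` K & forall v, K v \/ K (- v)].
Proof.
have [F FP totF|K [[KD KZ Ke KC] Kmax]] := @Zorn_bigcup _ proper_cone.
  split=> [u v [K FK Ku] [K' FK' Kv]|r v r0 [K FK Kv]|[K FK Ke]|].
  - have [s|s] := totF _ _ FK FK'.
      by exists K' => //; have [+ _ _ _] := FP _ FK'; apply=> //; exact: s.
    by exists K => //; have [+ _ _ _] := FP _ FK; apply=> //; exact: s.
  - by exists K => //; have [_ + _ _] := FP _ FK; apply.
  - by have [_ _ + _] := FP _ FK; apply.
  - have [[K FK CK]|noC] := pselect (exists2 K, F K & C0 `<=` K).
      by right=> v Cv; exists K => //; exact: CK.
    left; apply/seteqP; split=> // v [K FK Kv].
    by have [_ _ _ [K0|CK]] := FP _ FK; [rewrite K0 in Kv|apply: noC; exists K].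
have C00 : C0 0.
  have [r r0 C0r] := C0unit 0.
  by rewrite -(scale0r (r%:C *: e - 0)) -[0]/(0%:C); exact: C0Z.
have {}KC : C0 `<=` K.
  case: KC => // K0; have [] := Kmax C0.
    by rewrite K0; split=> // /(_ _ C00).
  by split=> //; [move=> r v /ltW; exact: C0Z|right].
exists K; split=> //.
(* If [v] is not in [K], then adjoining it produces [- e]. *)
have adjoin v : ~ K v -> exists2 t : R, 0 < t & K (- e - t%:C *: v).
  move=> nKv; apply: contrapT => not_t.
  pose K' := [set w | exists2 t : R, 0 <= t & K (w - t%:C *: v)].
  have KK' : K `<=` K' by move=> w Kw; exists 0; rewrite ?scale0r ?subr0.
  have [] := Kmax K'.
    split=> // /(_ v) K'K; apply: nKv; apply: K'K; exists 1 => //.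
    by rewrite scale1r subrr; exact: KC.
  split.
  - move=> u w [t t0 Kt] [s s0 Ks]; exists (t + s); first exact: addr_ge0.
    by rewrite rmorphD/= scalerDl opprD addrACA; exact: KD.
  - move=> r w r0 [t t0 Kt]; exists (r * t); first exact: mulr_ge0 (ltW r0) t0.
    by rewrite rmorphM/= -scalerA -scalerBr; exact: KZ.
  - move=> [t]; rewrite le_eqVlt => /predU1P[<-|t0 Kt].
      by rewrite scale0r subr0.
    by apply: not_t; exists t.
  - by right=> w /KC; exact: KK'.
move=> v; apply: contrapT => /not_orP[/adjoin[t t0 Kt] /adjoin[s s0 Ks]].
apply: Ke; have ts0 : 0 < t + s by exact: addr_gt0.
have -> : - e = (t + s)^-1%:C *:
    (s%:C *: (- e - t%:C *: v) + t%:C *: (- e - s%:C *: - v)).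
  have -> : s%:C *: (- e - t%:C *: v) + t%:C *: (- e - s%:C *: - v) =
      - ((t + s)%:C *: e).
    rewrite !scalerBr !scalerN !scalerA opprK addrACA [s%:C * _]mulrC addNr.
    by rewrite addr0 -opprD -scalerDl addrC rmorphD.
  by rewrite scalerN scalerA -rmorphM/= mulVf ?gt_eqF// scale1r.
by apply: (KZ); rewrite ?invr_gt0//; apply: (KD); exact: KZ.
Qed.

(** A proper cone with an order unit [e] carries a normalized functional:
    [f v] is the supremum of the [r] such that [v - r e] is in a maximal cone. *)
Lemma cone_state : exists f : E -> R,
  [/\ forall u v, f (u + v) = f u + f v,
      forall (r : R) v, f (r%:C *: v) = r * f v,
      f e = 1 & forall v, C0 v -> 0 <= f v].
Proof.
have [K [KD KZ Ke KC Ktot]] := maximal_cone.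
have Kpos (r : R) : 0 < r -> K (r%:C *: e).
  move=> r0; apply: (KZ) => //; have [s s0 /KC] := C0unit 0.
  rewrite subr0 => /(KZ s^-1); rewrite invr_gt0 => /(_ s0).
  by rewrite scalerA -rmorphM/= mulVf ?gt_eqF// scale1r.
have Kneg (r : R) : r < 0 -> ~ K (r%:C *: e).
  move=> r0 Kr; apply: Ke.
  have -> : - e = (- r)^-1%:C *: (r%:C *: e).
    by rewrite scalerA -rmorphM/= invrN mulNr mulVf ?lt_eqF// rmorphN1 scaleN1r.
  by apply: (KZ) => //; rewrite invr_gt0 oppr_gt0.
pose B v := [set r : R | K (v - r%:C *: e)].
pose f v := sup (B v).
have Bsup v : has_sup (B v).
  split.
    have [r r0 /KC Kr] := C0unit (- v); exists (- r).
    by rewrite /B/= rmorphN scaleNr opprK addrC -[v]opprK.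
  have [s s0 /KC Ks] := C0unit v; exists s => r Kr.
  rewrite leNgt; apply/negP => sr; have := KD _ _ Ks Kr.
  by rewrite addrA subrK -scalerBl -rmorphB/=; apply: Kneg; rewrite subr_lt0.
have f_lt v r : r < f v -> K (v - r%:C *: e).
  move=> /(sup_gt (proj1 (Bsup v)))[s Bs rs].
  have -> : v - r%:C *: e = (v - s%:C *: e) + (s - r)%:C *: e.
    by rewrite rmorphB/= scalerBl addrA subrK.
  by apply: (KD) => //; apply: Kpos; rewrite subr_gt0.
have f_gt v r : f v < r -> K (r%:C *: e - v).
  move=> fr; have [Kr|] := Ktot (v - r%:C *: e); last by rewrite opprB.
  by have := ub_le_sup (proj2 (Bsup v)) Kr; rewrite leNgt fr.
have f_eq v x : (forall r, r < x -> K (v - r%:C *: e)) ->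
    (forall r, x < r -> K (r%:C *: e - v)) -> f v = x.
  move=> lt_x gt_x; apply/eqP; rewrite eq_le !leNgt; apply/andP; split.
    apply/negP => xf; pose d := (f v - x) / 3.
    have d0 : 0 < d by rewrite divr_gt0 ?subr_gt0.
    have := KD _ _ (gt_x (x + d) _) (f_lt v (f v - d) _).
    rewrite addrA subrK -scalerBl -rmorphB/=.
    rewrite ltrDl ltrBlDr ltrDl => /(_ d0 d0); apply: Kneg.
    by rewrite /d; lra.
  apply/negP => xf; pose d := (x - f v) / 3.
  have d0 : 0 < d by rewrite divr_gt0 ?subr_gt0.
  have := KD _ _ (f_gt v (f v + d) _) (lt_x (x - d) _).
  rewrite addrA subrK -scalerBl -rmorphB/=.
  rewrite ltrDl ltrBlDr ltrDl => /(_ d0 d0); apply: Kneg.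
  by rewrite /d; lra.
have fD u v : f (u + v) = f u + f v.
  apply: f_eq => r rf.
    pose d := (f u + f v - r) / 2.
    have d0 : 0 < d by rewrite divr_gt0 ?subr_gt0.
    have := KD _ _ (f_lt u (f u - d) _) (f_lt v (f v - d) _).
    rewrite !ltrBlDr !ltrDl addrACA -opprD -scalerDl -rmorphD/= => /(_ d0 d0).
    by rewrite (_ : f u - d + _ = r)// /d; lra.
  pose d := (r - (f u + f v)) / 2.
  have d0 : 0 < d by rewrite divr_gt0 ?subr_gt0.
  have := KD _ _ (f_gt u (f u + d) _) (f_gt v (f v + d) _).
  rewrite !ltrDl addrACA -opprD -scalerDl -rmorphD/= => /(_ d0 d0).
  by rewrite (_ : f u + d + _ = r)// /d; lra.
have f0 : f 0 = 0 by apply: (addrI (f 0)); rewrite -fD !addr0.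
have fN v : f (- v) = - f v.
  by apply: (addrI (f v)); rewrite -fD !subrr f0.
have fZ (c : R) v : 0 < c -> f (c%:C *: v) = c * f v.
  move=> c0; have cV : c%:C * c^-1%:C = 1 by rewrite -rmorphM/= mulfV ?gt_eqF.
  apply: f_eq => r rf.
    have -> : c%:C *: v - r%:C *: e = c%:C *: (v - (c^-1 * r)%:C *: e).
      by rewrite scalerBr scalerA rmorphM/= mulrA cV mul1r.
    by apply: (KZ) => //; apply: f_lt; rewrite ltr_pdivrMl.
  have -> : r%:C *: e - c%:C *: v = c%:C *: ((c^-1 * r)%:C *: e - v).
    by rewrite scalerBr scalerA rmorphM/= mulrA cV mul1r.
  by apply: (KZ) => //; apply: f_gt; rewrite ltr_pdivlMl.
exists f; split=> //.
- move=> c v; have [c0|c0|->] := ltgtP c 0; last by rewrite scale0r f0 mul0r.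
    by rewrite -[c]opprK rmorphN scaleNr fN fZ ?oppr_gt0// !mulNr.
  exact: fZ.
- have e1 : 1%:C *: e = e by rewrite scale1r.
  by apply: f_eq => r rf; [rewrite -{1}e1|rewrite -{2}e1];
    rewrite -scalerBl -rmorphB/=; apply: Kpos; rewrite subr_gt0.
- move=> v /KC Kv; apply: ub_le_sup; first exact: (Bsup v).2.
  by rewrite /B/= scale0r subr0.
Qed.

End ConeState.

(** Every real-linear functional is the real part of a complex-linear one. *)
Lemma complexification (R : realType) (E : lmodType R[i]) (f : E -> R) :
  (forall u v, f (u + v) = f u + f v) ->
  (forall (r : R) v, f (r%:C *: v) = r * f v) ->
  exists w : {scalar E}, forall v, w v = (f v)%:C - 'i * (f ('i *: v))%:C.
Proof.
move=> fD fZ; apply: ex_scalar => a u v.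
have fC (x : R[i]) w :
    f (x *: w) = (complex.Re x : R) * f w + (complex.Im x : R) * f ('i *: w).
  rewrite -(fZ (complex.Re x)) -(fZ (complex.Im x)) -fD scalerA -scalerDl.
  by congr (f (_ *: _)); rewrite [LHS]complexE mulrC.
have fi w : f ('i *: ('i *: w)) = - f w.
  by rewrite scalerA -expr2 sqrCi -[RHS]mulN1r -fZ rmorphN1.
rewrite scalerDr [X in 'i * (f (X + _))%:C]scalerA [in 'i * a]mulrC -scalerA !fD (fC a u).
rewrite (fC a ('i *: u)) fi.
rewrite [a in RHS]complexE complexiE !(rmorphD, rmorphM, rmorphN)/=.
set ra := (complex.Re a)%:C; set ia := (complex.Im a)%:C.
have ii : 'i * 'i = -1 :> R[i] by rewrite -expr2 sqrCi.
apply/eqP; rewrite -subr_eq0; apply/eqP.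
transitivity (('i * 'i + 1) * ia * (f ('i *: u))%:C); last by rewrite ii addNr !mul0r.
ring.
Qed.

Section Separation.
Variables (R : realType) (V : matOrdType R).
Hypothesis OS : operator_system V.
Local Notation C := R[i].

(** If [- 1] is positive, then the positive cone is trivial. *)
Lemma tens1_eq0 n : mpos (- tens1 V 1%:M : 'M[V]_n) ->
  forall A : 'M[V]_n, mpos A -> A = 0.
Proof.
move=> neg1 A Ap.
have /(mpos_proper OS (mpos_tens1_1 OS n)) one0 := neg1.
apply: (mpos_proper OS Ap).
have [r r0] := matrix_order_unit OS (mpos_selfadjoint OS Ap).
rewrite tens1_scalar one0 (_ : scale_mx _ 0 = 0) ?sub0r//.
by apply/matrixP => i j; rewrite !mxE scaler0.
Qed.

(** The Hahn-Banach separation theorem for an operator system. *)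
Theorem state_separation n (A : 'M[V]_n) : starmx A = A -> ~ mpos A ->
  exists2 w : {scalar mxsys V n}, mx_state w & w A < 0.
Proof.
move=> sA nA.
have [d d0 ndA] : exists2 d : R, 0 < d & ~ mpos (tens1 V d%:C%:M + A).
  apply: contrapT => h; apply: nA; apply: (mpos_archimedean OS) => r r0.
  by apply: contrapT => h'; apply: h; exists r.
pose E := mxsys V n; pose e : E := tens1 V 1%:M.
pose re (B : E) : E := B + starmx B.
pose y : E := d%:C *: e + A.
have rey : re y = 2%:R%:C *: y.
  rewrite /re /y [starmx _]starmxD starmxZ sA conj_real_complex.
  rewrite (_ : starmx e = e) ?rmorph_nat ?scaler_nat//.
  by rewrite starmx_tens1 trmx1 map_mx1.
have reD B B' : re (B + B') = re B + re B'.
  by rewrite /re [starmx _]starmxD addrACA.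
have reZ (r : R) B : re (r%:C *: B) = r%:C *: re B.
  by rewrite /re [starmx _]starmxZ conj_real_complex scalerDr.
(* The cone of elements with positive real part, enlarged by [- y]: a functional
   that is nonnegative on it is nonpositive at [y] and vanishes on the
   antiselfadjoint elements. *)
pose C0 : set E := [set B | exists2 t : R, 0 <= t & mpos (re (B + t%:C *: y))].
have C0p B : mpos (re B) -> C0 B by move=> Bp; exists 0; rewrite ?scale0r ?addr0.
have mp2 B : mpos (B + B : E) -> mpos B.
  move=> Bp; apply: (mposZ_gt0 OS (_ : 0 < 2%:R)) => //.
  by rewrite -[scale_mx _ _]/(2%:R%:C *: (B : E)) rmorph_nat scaler_nat.
have ePos : mpos e by exact: mpos_tens1_1.
have se : starmx e = e by rewrite starmx_tens1 trmx1 map_mx1.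
have properC : ~ C0 (- e).
  move=> [t]; rewrite le_eqVlt => /predU1P[<-|t0].
    rewrite scale0r addr0 /re [starmx _]starmxN se => /mp2 neg1.
    have [r r0 [rA rA']] := order_unitP OS sA.
    apply: nA; have /eqP := tens1_eq0 neg1 rA; rewrite subr_eq0 => /eqP <-.
    exact: (mpos_tens1_real OS _ (ltW r0)).
  rewrite reD reZ rey /re [starmx _]starmxN se.
  rewrite [X in _ + X](_ : _ = t%:C *: y + t%:C *: y); last first.
    by rewrite rmorph_nat scaler_nat -scalerMnr mulr2n.
  rewrite addrACA => /mp2 ty; apply: ndA.
  rewrite tens1_scalar; apply: (mposZ_gt0 OS t0).
  rewrite -[scale_mx _ _]/(t%:C *: y).
  have -> : t%:C *: y = (- e + t%:C *: y) + e by rewrite addrAC addNr add0r.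
  exact: (mposD OS).
have [||B||f [fD fZ fe fpos]] := @cone_state R E e C0.
- move=> B B' [t t0 Bt] [t' t0' Bt']; exists (t + t'); first exact: addr_ge0.
  by rewrite rmorphD/= scalerDl addrACA reD; exact: (mposD OS).
- move=> r B r0 [t t0 Bt]; exists (r * t); first exact: mulr_ge0.
  by rewrite rmorphM/= -scalerA -scalerDr reZ; exact: (mposZ OS).
- have [|r r0 rB] := @matrix_order_unit _ _ OS n (re B).
    by rewrite /re [LHS]starmxD starmxK addrC.
  exists r => //; apply: C0p; rewrite reD.
  rewrite reZ /re se [starmx (- B)]starmxN -opprD scalerDr -addrA.
  apply: (mposD OS); last by move: rB; rewrite tens1_scalar.
  exact: (mposZ OS (ltW r0)).
- exact: properC.
have f_re0 B : re B = 0 -> f B = 0.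
  move=> reB; apply/eqP; rewrite eq_le fpos ?andbT; last first.
    by apply: C0p; rewrite reB; exact: (mpos0 OS).
  rewrite -oppr_ge0 -mulN1r -fZ rmorphN1 scaleN1r fpos//; apply: C0p.
  by rewrite -scaleN1r -(rmorphN1 (real_complex R)) reZ reB scaler0; exact: (mpos0 OS).
have f_i (B : E) : starmx B = B -> f ('i *: B) = 0.
  move=> sB; apply: f_re0.
  by rewrite /re [starmx _]starmxZ sB conjCi -[scale_mx _ _]/(- 'i *: B) scaleNr subrr.
have [w wE] := complexification fD fZ.
have wsa (B : E) : starmx B = B -> w B = (f B)%:C.
  by move=> sB; rewrite wE f_i// rmorph0 mulr0 subr0.
exists w.
  split=> [|B Bp]; first by rewrite (wsa e se) fe.
  rewrite wsa ?ler0c; last exact: (mpos_selfadjoint OS).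
  apply: fpos; apply: C0p.
  by rewrite /re (mpos_selfadjoint OS Bp); exact: (mposD OS).
have fy : f y <= 0.
  rewrite -oppr_ge0 -mulN1r -fZ rmorphN1 scaleN1r; apply: fpos; exists 1 => //.
  rewrite scale1r addNr /re add0r [starmx _](_ : _ = 0); last first.
    by apply/matrixP => i j; rewrite !mxE star0.
  exact: (mpos0 OS).
rewrite (wsa A sA) -[X in _ < X]/(0%:C) ltcR.
by move: fy; rewrite fD fZ fe mulr1; lra.
Qed.

End Separation.

(** * Operator systems whose cones are given by functionals *)

Section Criterion.
Variables (R : realType) (V : matOrdType R).
Local Notation C := R[i].
Variable Omega : forall n, set {scalar mxsys V n}.
Hypothesis Omega_mpos : forall n (A : 'M[V]_n),
  mpos A <-> forall w, Omega w -> 0 <= w A.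
Hypothesis Omega_herm : forall n (w : {scalar mxsys V n}) (A : 'M[V]_n),
  Omega w -> w (starmx A) = (w A)^*.
Hypothesis Omega_unit : forall n (w : {scalar mxsys V n}),
  Omega w -> 0 <= w (tens1 V 1%:M).
Hypothesis Omega_sep : forall n (A : 'M[V]_n),
  (forall w, Omega w -> w A = 0) -> A = 0.
Hypothesis Omega_cong : forall n m (X : 'M[C]_(n, m)) (w : {scalar mxsys V m}),
  Omega w -> exists2 w' : {scalar mxsys V n},
    Omega w' & forall A, w (congmx X A) = w' A.
Hypothesis Omega_bounded : forall n (A : 'M[V]_n), starmx A = A ->
  exists2 r : R, 0 < r &
    forall w, Omega w -> w A <= r%:C * w (tens1 V 1%:M).

(** If positivity is tested by a sufficiently rich family [Omega] of bounded
    functionals that is stable under compressions, then the axioms of an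
    operator system hold. *)
Lemma operator_system_functionals : operator_system V.
Proof.
split.
- move=> n A /Omega_mpos Ap; apply/eqP; rewrite -subr_eq0; apply/eqP.
  apply: Omega_sep => w Ow; rewrite mxfunB Omega_herm//.
  by rewrite (CrealP (ger0_real (Ap _ Ow))) subrr.
- by move=> n; apply/Omega_mpos => w _; rewrite mxfun0.
- move=> n A B /Omega_mpos Ap /Omega_mpos Bp; apply/Omega_mpos => w Ow.
  by rewrite mxfunD addr_ge0 ?Ap ?Bp.
- move=> n r A r0 /Omega_mpos Ap; apply/Omega_mpos => w Ow.
  by rewrite mxfunZ mulr_ge0 ?ler0c ?Ap.
- move=> n A /Omega_mpos Ap /Omega_mpos An; apply: Omega_sep => w Ow.
  by apply/eqP; rewrite eq_le Ap// andbT -oppr_ge0 -mxfunN An.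
- move=> n m X A /Omega_mpos Ap; apply/Omega_mpos => w /(Omega_cong X)[w' Ow' ->].
  exact: Ap.
- move=> n A /Omega_bounded[r r0 rA]; exists r => //; apply/Omega_mpos => w Ow.
  by rewrite mxfunB tens1_scalar mxfunZ subr_ge0 rA.
- move=> n A Ap; apply/Omega_mpos => w Ow.
  have w1 := Omega_unit Ow.
  have Apw (r : R) : 0 < r -> 0 <= r%:C * w (tens1 V 1%:M) + w A.
    move=> r0; have /Omega_mpos/(_ w Ow) := Ap r r0.
    by rewrite mxfunD tens1_scalar mxfunZ.
  have [c wc] : exists c : R, w (tens1 V 1%:M) = c%:C.
    by exists (complex.Re (w (tens1 V 1%:M))); rewrite RRe_real// ger0_real.
  move: w1 Apw; rewrite wc ler0c => c0 Apw.
  have [a wa] : exists a : R, w A = a%:C.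
    exists (complex.Re (w A)); rewrite RRe_real//.
    rewrite -[w A](addKr (1%:C * c%:C)) rpredD//; last exact/ger0_real/Apw.
    by rewrite -rmorphM/= rpredN ger0_real// ler0c mul1r.
  rewrite wa ler0c leNgt; apply/negP => a0.
  pose r := - a / (2 * (c + 1)).
  have c1 : 0 < 2 * (c + 1) by lra.
  have r0 : 0 < r by rewrite divr_gt0// oppr_gt0.
  have := Apw r r0; rewrite wa -rmorphM -rmorphD/= ler0c leNgt => /negP; apply.
  have rc : r * (2 * (c + 1)) = - a by rewrite /r divfK// gt_eqF.
  nra.
Qed.

End Criterion.

(** * The operator system of affine matrix-valued functions on the interval *)

Section PsdForms.
Variable R : realType.
Local Notation C := R[i].

Lemma psd_psdform n (A : 'M[C]_n) : psd A <-> psdform (fun i j => A i j).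
Proof.
have qE (v : 'I_n -> C) :
    ((map_mx Num.conj (\col_i v i))^T *m A *m \col_i v i) 0 0 =
    qform (fun i j => A i j) v.
  rewrite /qform mxE exchange_big/=; apply: eq_bigr => j _.
  by rewrite !mxE mulr_suml; apply: eq_bigr => i _; rewrite !mxE.
split=> [Ap v|Ap v]; first by rewrite -qE; exact: Ap.
have -> : v = \col_i v i 0 by apply/colP => i; rewrite mxE.
by rewrite qE; exact: Ap.
Qed.

Lemma psdform_reindex (S T : finType) (h : S -> T) (Q : T -> T -> C) :
  bijective h -> psdform (fun p q => Q (h p) (h q)) <-> psdform Q.
Proof.
move=> [g hK gK]; split=> [/(psdform_comp g)|]; last exact: psdform_comp.
congr psdform; apply/funext => p; apply/funext => q.
by rewrite !gK.
Qed.

End PsdForms.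

Section FrakC.
Variables (R : realType) (k : nat).
Local Notation C := R[i].
Local Notation U := (unit_interval R).

(** The [(a, b)] entry of the matrix [F t]. *)
Definition fev (t : U) (F : frakC R k) (a b : 'I_k) : C :=
  val ((val F : 'M[C01 R]_k) a b) t.

Lemma fev_linear t (x : C) (F G : frakC R k) a b :
  fev t (x *: F + G) a b = x * fev t F a b + fev t G a b.
Proof. by rewrite /fev /= !mxE. Qed.

Lemma fev_star t (F : frakC R k) a b : fev t (star F) a b = (fev t F b a)^*.
Proof. by rewrite /fev /= !mxE. Qed.

Lemma fev_unit t a b : fev t (unit_elt (frakC R k)) a b = (a == b)%:R.
Proof. by rewrite /fev /= !mxE /=; case: eqP => _; rewrite ?scale1r ?scale0r. Qed.

Lemma fev_inj (F G : frakC R k) :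
  (forall t a b, fev t F a b = fev t G a b) -> F = G.
Proof.
move=> FG; apply/val_inj/matrixP => a b; apply/val_inj/funext => t.
exact: FG.
Qed.

(** Positivity is pointwise positive semidefiniteness, the rows and columns
    being indexed by pairs instead of by the flattening of block matrices. *)
Lemma frakC_mpos n (A : 'M[frakC R k]_n) : mpos A <->
  forall t : U, psdform (fun p q : 'I_n * 'I_k => fev t (A p.1 q.1) p.2 q.2).
Proof.
pose h (s : 'I_(\sum_(i < n) k)) : 'I_n * 'I_k :=
  (tagnat.sig1 s, tagnat.sig2 s).
have hb : bijective h.
  apply: inj_card_bij; last first.
    by rewrite card_prod !card_ord sum_nat_const card_ord.
  apply: (@can_inj _ _ _ (fun p => tagnat.Rank p.1 p.2)).
  exact: tagnat.sig2K.
pose M t : 'M[C]_(\sum_(i < n) k) :=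
  \matrix_(s, s') fev t (A (h s).1 (h s').1) (h s).2 (h s').2.
have ME t : psd (M t) <->
    psdform (fun p q : 'I_n * 'I_k => fev t (A p.1 q.1) p.2 q.2).
  rewrite psd_psdform -(psdform_reindex _ hb).
  suff -> : (fun i j => M t i j) =
      (fun p q => fev t (A (h p).1 (h q).1) (h p).2 (h q).2) by [].
  by apply/funext => i; apply/funext => j; rewrite mxE.
suff -> : mpos A = forall t, psd (M t).
  by split=> Ap t; apply/ME; exact: Ap.
rewrite /mpos/= /subsys_mpos/= /mpos/= /mxsys_mpos/= /mpos/= /contfun_mpos/=.
apply: eq_forall => t; congr psd; apply/matrixP => s s'.
by rewrite !mxE.
Qed.

(** Boundedness, which provides the order unit, passes from the generators to
    their span. *)
Lemma frakC_bounded (F : frakC R k) :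
  exists M : R, forall t a b, `|fev t F a b| <= M%:C.
Proof.
pose J : {pred mxsys (C01 R) k} := fun G => `[< exists M : R,
  forall (t : U) a b, `|val ((G : 'M[C01 R]_k) a b) t| <= M%:C >].
suff : val F \in J by move=> /asboolP.
apply: (@span_ind _ _ (@frakC_gen R k) J); last exact: (valP F).
  split=> [|x G H]; rewrite !unfold_in.
    by apply/asboolP; exists 0 => t a b; rewrite mxE normr0.
  move=> /asboolP[M GM] /asboolP[N HN]; apply/asboolP.
  have [r xr] : exists r : R, `|x| = r%:C.
    by exists (complex.Re `|x|); rewrite RRe_real// normr_real.
  exists (r * M + N) => t a b; rewrite !mxE/=.
  apply: le_trans (ler_normD _ _) _; rewrite rmorphD rmorphM/= -xr.
  apply: lerD; last exact: HN.
  rewrite -[(x *: _) t]/(x * val ((G : 'M[C01 R]_k) a b) t) normrM.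
  by rewrite ler_wpM2l.
have gen (f : C01 R) (i j : 'I_k) : (forall t, `|val f t| <= 1) ->
    elem_tens i j f \in J.
  move=> f1; rewrite unfold_in; apply/asboolP; exists 1 => t a b.
  by rewrite mxE; case: ifP => _; [exact: f1|rewrite normr0 ler01].
move=> _ [[i [j ->]]|[i [j ->]]]; apply: gen => t; first by rewrite normr1.
have /andP[t0 t1] : 0 <= val t <= 1 by have := set_valP t; rewrite /= in_itv.
by rewrite /= ger0_norm ?ler0c// (_ : 1 = 1%:C) ?lecR.
Qed.

(** The functional [A |-> v^* A(t) v] on matrices over the system. *)
Definition frakC_form n t (v : 'I_n * 'I_k -> C) (A : 'M[frakC R k]_n) : C :=
  qform (fun p q => fev t (A p.1 q.1) p.2 q.2) v.

Lemma frakC_form_scalar n t (v : 'I_n * 'I_k -> C) :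
  scalar (frakC_form t v : mxsys (frakC R k) n -> C).
Proof.
move=> x A B; rewrite /frakC_form /qform mulr_sumr -big_split/=.
apply: eq_bigr => p _; rewrite mulr_sumr -big_split/=.
by apply: eq_bigr => q _; rewrite !mxE fev_linear; ring.
Qed.

Lemma frakC_form_herm n t (v : 'I_n * 'I_k -> C) A :
  frakC_form t v (starmx A) = (frakC_form t v A)^*.
Proof.
rewrite /frakC_form /qform rmorph_sum exchange_big/=; apply: eq_bigr => q _.
rewrite rmorph_sum; apply: eq_bigr => p _.
by rewrite !mxE fev_star !rmorphM/= conjCK mulrC mulrA mulrAC.
Qed.

Lemma frakC_form_unit n t (v : 'I_n * 'I_k -> C) :
  frakC_form t v (tens1 (frakC R k) 1%:M) = \sum_p `|v p| ^+ 2.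
Proof.
rewrite /frakC_form /qform; apply: eq_bigr => p _; rewrite normCK.
have fE q : fev t (tens1 (frakC R k) 1%:M p.1 q.1 ) p.2 q.2 = (q == p)%:R.
  rewrite mxE -[_ *: _]addr0 fev_linear mxE fev_unit.
  rewrite (_ : fev t 0 _ _ = 0) ?addr0; last by rewrite /fev/= !mxE.
  by rewrite -natrM mulnb [q == p]eq_sym.
by under eq_bigr => q _ do rewrite fE mulrAC; rewrite sum_delta mulrC.
Qed.

Lemma frakC_form_eq0 n (A : 'M[frakC R k]_n) :
  (forall t v, frakC_form t v A = 0) -> A = 0.
Proof.
move=> A0; apply/matrixP => i j; apply: fev_inj => t a b.
rewrite mxE [RHS](_ : _ = 0); last by rewrite /fev/= !mxE.
apply: (@psdform_anti _ _ (fun p q => fev t (A p.1 q.1) p.2 q.2) _ _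
  (i, a) (j, b)) => v; first by rewrite -/(frakC_form t v A) A0.
suff -> : qform (fun p q => - fev t (A p.1 q.1) p.2 q.2) v = - frakC_form t v A.
  by rewrite A0 oppr0.
rewrite /frakC_form /qform -sumrN; apply: eq_bigr => p _.
by rewrite -sumrN; apply: eq_bigr => q _; rewrite mulrN mulNr.
Qed.

Lemma frakC_form_cong n m (X : 'M[C]_(n, m)) t (v : 'I_m * 'I_k -> C) A :
  frakC_form t v (congmx X A) =
  frakC_form t (fun p => \sum_i X p.1 i * v (i, p.2)) A.
Proof.
have fev_sum (I : finType) (F : I -> frakC R k) a b :
    fev t (\sum_i F i) a b = \sum_i fev t (F i) a b.
  apply: (big_morph (fun G => fev t G a b)) => [G H|].
    by rewrite -[G]scale1r fev_linear mul1r scale1r.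
  by rewrite /fev/= !mxE.
have fevZ x F a b : fev t (x *: F) a b = x * fev t F a b.
  by rewrite -[_ *: _]addr0 fev_linear (_ : fev t 0 a b = 0) ?addr0// /fev/= !mxE.
pose T i j a b p q := (v (i, a))^* * ((X p i)^* * X q j * fev t (A p q) a b) *
  v (j, b).
transitivity (\sum_i \sum_a \sum_j \sum_b \sum_p \sum_q T i j a b p q).
  rewrite /frakC_form /qform [RHS]pair_bigA/=; apply: eq_bigr => -[i a] _ /=.
  rewrite [RHS]pair_bigA/=; apply: eq_bigr => -[j b] _ /=.
  rewrite mxE fev_sum mulr_sumr mulr_suml; apply: eq_bigr => p _.
  rewrite fev_sum mulr_sumr mulr_suml; apply: eq_bigr => q _.
  by rewrite fevZ.
transitivity (\sum_p \sum_a \sum_q \sum_b \sum_i \sum_j T i j a b p q).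
  transitivity (\sum_a \sum_b \sum_i \sum_j \sum_p \sum_q T i j a b p q).
    rewrite exchange_big; apply: eq_bigr => a _.
    under eq_bigr => i _ do rewrite exchange_big.
    by rewrite exchange_big.
  transitivity (\sum_a \sum_b \sum_p \sum_q \sum_i \sum_j T i j a b p q).
    apply: eq_bigr => a _; apply: eq_bigr => b _.
    transitivity (\sum_i \sum_p \sum_j \sum_q T i j a b p q).
      by apply: eq_bigr => i _; rewrite exchange_big.
    rewrite exchange_big; apply: eq_bigr => p _.
    transitivity (\sum_i \sum_q \sum_j T i j a b p q).
      by apply: eq_bigr => i _; rewrite exchange_big.
    by rewrite exchange_big.
  rewrite [RHS]exchange_big; apply: eq_bigr => a _.
  under [RHS]eq_bigr => p _ do rewrite exchange_big.
  by rewrite [RHS]exchange_big.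
rewrite /frakC_form /qform [LHS]pair_bigA/=; apply: eq_bigr => -[p a] _ /=.
rewrite [LHS]pair_bigA/=; apply: eq_bigr => -[q b] _ /=.
rewrite rmorph_sum !mulr_suml; apply: eq_bigr => i _.
rewrite mulr_sumr; apply: eq_bigr => j _.
by rewrite /T rmorphM/=; ring.
Qed.

Theorem frakC_operator_system : operator_system (frakC R k).
Proof.
pose Omega n : set {scalar mxsys (frakC R k) n} :=
  [set w | exists t v, forall A, w A = frakC_form t v A].
have form_Omega n t v : exists2 w, Omega n w & forall A, w A = frakC_form t v A.
  have [w wE] := ex_scalar (@frakC_form_scalar n t v).
  by exists w => //; exists t, v.
apply: (@operator_system_functionals _ _ Omega).
- move=> n A; rewrite frakC_mpos; split=> [Ap w [t [v ->]]|Ap t v].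
    exact: Ap.
  by have [w Ow wE] := form_Omega n t v; have := Ap w Ow; rewrite wE.
- by move=> n w A [t [v wE]]; rewrite !wE frakC_form_herm.
- move=> n w [t [v ->]]; rewrite frakC_form_unit; apply: sumr_ge0 => p _.
  exact: exprn_ge0.
- move=> n A A0; apply: frakC_form_eq0 => t v.
  by have [w Ow <-] := form_Omega n t v; exact: A0.
- move=> n m X w [t [v wE]].
  have [w' Ow' w'E] := form_Omega n t (fun p => \sum_i X p.1 i * v (i, p.2)).
  by exists w' => // A; rewrite wE w'E frakC_form_cong.
- move=> n A sA.
  have /choice[M MP] : forall p : 'I_n * 'I_n, exists M : R,
      forall t a b, `|fev t (A p.1 p.2) a b| <= M%:C.
    by move=> p; exact: frakC_bounded.
  pose N := \sum_p `|M p|.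
  have N0 : 0 <= N by apply: sumr_ge0.
  exists (#|{: 'I_n * 'I_k}|%:R * N + 1).
    by apply: ltr_wpDl => //; exact: mulr_ge0.
  move=> w [t [v wE]]; rewrite !wE frakC_form_unit.
  have wR : frakC_form t v A \is Num.real.
    by apply/CrealP; rewrite -frakC_form_herm sA.
  apply: le_trans (real_ler_norm wR) _.
  apply: le_trans (@qform_bound _ _ _ v N%:C _ _) _; first by rewrite ler0c.
    move=> p q; apply: le_trans (MP (p.1, q.1) t p.2 q.2) _; rewrite lecR.
    rewrite /N (bigD1 (p.1, q.1))//=; apply: le_trans (ler_norm _) _.
    by rewrite lerDl; apply: sumr_ge0.
  rewrite rmorphD rmorphM/= rmorph_nat; apply: ler_wpM2r.
    by apply: sumr_ge0 => p _; exact: exprn_ge0.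
  by rewrite lerDl (_ : 0 = 0%:C) ?lecR.
Qed.

End FrakC.

(** * Coproducts *)

Section CoproductElements.
Variables (R : realType) (L : choiceType) (V : L -> matOrdType R).
Local Notation C := R[i].
Local Notation emb l := (@oplus1_inj R L V l).

Lemma val_dinj l (v : V l) m :
  val (dinj (V := V) v) m = dfwith (0 : dprod V) l v m.
Proof. by []. Qed.

Lemma dinj_is_linear l : linear (@dinj C L V l).
Proof.
move=> a u v; apply/val_inj/functional_extensionality_dep => m.
rewrite val_dinj -[RHS]/(a *: val (dinj u) m + val (dinj v) m) !val_dinj.
have [<-|lm] := eqVneq l m; first by rewrite !dfwithin.
by rewrite !dfwithout// -[_ *: _]/(a *: (0 : V m)) scaler0 addr0.
Qed.

Lemma oplus1_inj_is_linear l : linear (@oplus1_inj R L V l).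
Proof. by move=> a u v; rewrite /oplus1_inj dinj_is_linear linearP. Qed.
HB.instance Definition _ l :=
  GRing.isLinear.Build C (V l) (oplus1 V) _ (@oplus1_inj R L V l)
    (@oplus1_inj_is_linear l).

Lemma oplus1_inj_unit l : emb l (unit_elt (V l)) = unit_elt (oplus1 V).
Proof. exact: (esym (oplus1_unitE V l)). Qed.

Lemma oplus1_inj_star l (v : V l) : star (emb l v) = emb l (star v).
Proof. by rewrite -[LHS]/(oplus1_star _) oplus1_starE dsum_star_inj. Qed.

Lemma map_inj_tens1 n l (a : 'M[C]_n) :
  map_mx (emb l) (tens1 (V l) a) = tens1 (oplus1 V) a.
Proof. by apply/matrixP => i j; rewrite !mxE linearZ/= oplus1_inj_unit. Qed.

Lemma map_inj_star n l (A : 'M[V l]_n) :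
  starmx (map_mx (emb l) A) = map_mx (emb l) (starmx A).
Proof. by apply/matrixP => i j; rewrite !mxE oplus1_inj_star. Qed.

Lemma map_inj_cong n m l (X : 'M[C]_(n, m)) (A : 'M[V l]_n) :
  congmx X (map_mx (emb l) A) = map_mx (emb l) (congmx X A).
Proof.
apply/matrixP => i j; rewrite !mxE linear_sum; apply: eq_bigr => p _.
by rewrite linear_sum; apply: eq_bigr => q _; rewrite mxE linearZ.
Qed.

(** The support of an element of the direct sum. *)
Definition dsum_supp (x : dsum V) : {fset L} := fset_set [set l | val x l <> 0].

Lemma mem_dsum_supp (x : dsum V) l : (l \in dsum_supp x) = (val x l != 0).
Proof.
have /asboolP fx := valP x; rewrite in_fset_set//.
by apply/idP/idP => [/set_mem/= /eqP//|/eqP h]; exact: mem_set.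
Qed.

Section UniversalMap.
Variables (W : lmodType C) (f : forall l, {linear V l -> W}) (e : W).
Hypothesis f_unit : forall l, f l (unit_elt (V l)) = e.

Let D (x : dsum V) : W := \sum_(l <- dsum_supp x) f l (val x l).

Let DE (x : dsum V) (F : {fset L}) : {subset dsum_supp x <= F} ->
  D x = \sum_(l <- F) f l (val x l).
Proof.
move=> sF; apply: big_fset_incl; first exact/fsubsetP.
by move=> l _; rewrite mem_dsum_supp negbK => /eqP ->; rewrite linear0.
Qed.

Let D_is_linear : linear D.
Proof.
move=> a x y; pose F := (dsum_supp x `|` dsum_supp y `|` dsum_supp (a *: x + y)%R)%fset.
rewrite (@DE x F) ?(@DE y F) ?(@DE (a *: x + y) F); first last.
- by move=> l lx; rewrite !inE lx.
- by move=> l lx; rewrite !inE lx !orbT.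
- by move=> l lx; rewrite !inE lx !orbT.
rewrite scaler_sumr -big_split/=; apply: eq_bigr => l _.
by rewrite -linearP.
Qed.

Let D_dinj l (v : V l) : D (dinj v) = f l v.
Proof.
rewrite (@DE _ [fset l]%fset) ?big_seq_fset1 ?val_dinj ?dfwithin// => m.
rewrite mem_dsum_supp val_dinj inE; apply: contraNT => ml.
by rewrite dfwithout// eq_sym.
Qed.

(** A family of linear maps that agree on the units factors through the
    coproduct. *)
Lemma oplus1_universal : exists g : {linear oplus1 V -> W},
  forall l v, g (emb l v) = f l v.
Proof.
have [d dE] := ex_linear D_is_linear.
have d_span x : x \in Defs.span (@unit_diff R L V) -> d x = 0.
  move=> xs; suff : x \in kernel d by move=> /eqP.
  apply: Defs.span_ind xs; first exact: kernel_closed.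
  move=> _ [l [m ->]]; rewrite /= -[_ \in _]/(d _ == 0) linearB/= !dE.
  by rewrite !D_dinj !f_unit subrr.
pose g (q : oplus1 V) : W := d (class_repr q).
have gE x : g (class (Defs.span (@unit_diff R L V)) x) = d x.
  apply/eqP; rewrite -subr_eq0 -linearB d_span//.
  by rewrite -class_eq class_reprK.
have [|h hE] := @ex_linear _ _ _ g.
  move=> a x y; rewrite -[x]class_reprK -[y]class_reprK -linearP !gE.
  by rewrite linearP.
by exists h => l v; rewrite hE gE dE D_dinj.
Qed.

End UniversalMap.

Lemma dsum_decomposition (x : dsum V) :
  x = \sum_(l <- dsum_supp x) dinj (val x l).
Proof.
have val_sum I (r : seq I) (G : I -> dsum V) m :
    val (\sum_(i <- r) G i) m = \sum_(i <- r) val (G i) m.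
  exact: (big_morph (fun y : dsum V => val y m)).
apply/val_inj/functional_extensionality_dep => m; rewrite val_sum.
have [ms|ms] := boolP (m \in dsum_supp x).
  rewrite (big_fsetD1 m ms) val_dinj dfwithin big_seq big1 => [|l].
    by rewrite /= addr0.
  by rewrite !inE => /andP[lm _]; rewrite val_dinj dfwithout.
move: (ms); rewrite mem_dsum_supp negbK => /eqP ->.
rewrite big_seq big1// => l lx; rewrite val_dinj dfwithout//.
by apply: contraNneq ms => <-.
Qed.

Lemma oplus1_decomposition (q : oplus1 V) : exists (F : {fset L}) (x : dprod V),
  (forall l, l \notin F -> x l = 0) /\ q = \sum_(l <- F) emb l (x l).
Proof.
exists (dsum_supp (class_repr q)), (val (class_repr q)).
split=> [l|]; first by rewrite mem_dsum_supp negbK => /eqP.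
rewrite -[LHS]class_reprK {1}[class_repr q]dsum_decomposition.
by rewrite linear_sum.
Qed.

Lemma oplus1_mx_decomposition n (A : 'M[oplus1 V]_n) :
  exists (F : {fset L}) (x : forall l, 'M[V l]_n),
    A = \sum_(l <- F) map_mx (emb l) (x l).
Proof.
have /choice[G GP] (p : 'I_n * 'I_n) := oplus1_decomposition (A p.1 p.2).
have /choice[y yP] := GP.
pose F := \big[fsetU/fset0]_p G p.
exists F, (fun l => \matrix_(i, j) y (i, j) l); apply/matrixP => i j.
have [y0 ->] := yP (i, j); rewrite summxE.
transitivity (\sum_(l <- F) emb l (y (i, j) l)); last first.
  by apply: eq_bigr => l _; rewrite !mxE.
apply: big_fset_incl => [|l _ lG]; last by rewrite y0// linear0.
by apply: bigfcup_sup; rewrite ?mem_index_enum.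
Qed.

(** A family of functionals on the matrices over the [V l] that agree on the
    scalar matrices comes from a functional on the matrices over the
    coproduct. *)
Lemma oplus1_mx_universal n (w : forall l, {scalar mxsys (V l) n}) :
  (forall l m a, w l (tens1 (V l) a) = w m (tens1 (V m) a)) ->
  exists W : {scalar mxsys (oplus1 V) n},
    forall l (A : 'M[V l]_n), W (map_mx (emb l) A) = w l A.
Proof.
move=> w_eq.
(* The matrix with [v] in position [(i, j)] and [0] elsewhere. *)
pose single l (i j : 'I_n) (v : V l) : 'M[V l]_n :=
  \matrix_(a, b) (if (a == i) && (b == j) then v else 0).
have singleP l i j a (u v : V l) :
    single l i j (a *: u + v) = scale_mx a (single l i j u) + single l i j v.
  apply/matrixP => b c; rewrite !mxE; case: ifP => // _.
  by rewrite scaler0 addr0.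
have /choice[g gP] (p : 'I_n * 'I_n) : exists g : {linear oplus1 V -> C^o},
    forall l v, g (emb l v) = w l (single l p.1 p.2 v).
  have u_ex l : exists u : {linear V l -> C^o},
      forall v, u v = w l (single l p.1 p.2 v).
    apply: (@ex_linear _ (V l) C^o) => a x y.
    by rewrite singleP mxfunD mxfunZ.
  pose u l := sval (cid (u_ex l)).
  have uE l v : u l v = w l (single l p.1 p.2 v).
    by rewrite /u; case: cid.
  have single_unit l : single l p.1 p.2 (unit_elt (V l)) =
      tens1 (V l) (delta_mx p.1 p.2).
    apply/matrixP => a b; rewrite !mxE; case: ifP => _;
    by rewrite ?scale1r ?scale0r.
  have [[l0 _]|noL] := pselect (exists l : L, True); last first.
    have [|g gE] := @oplus1_universal C^o u 0.
      by move=> l; case: noL; exists l.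
    by exists g => l; case: noL; exists l.
  have [|g gE] := @oplus1_universal C^o u (u l0 (unit_elt (V l0))).
    by move=> l; rewrite !uE !single_unit; exact: w_eq.
  by exists g => l v; rewrite gE uE.
have [|W WE] := @ex_scalar _ (mxsys (oplus1 V) n)
    (fun A => \sum_i \sum_j g (i, j) ((A : 'M_n) i j)).
  move=> a A B; rewrite mulr_sumr -big_split/=; apply: eq_bigr => i _.
  rewrite mulr_sumr -big_split/=; apply: eq_bigr => j _.
  by rewrite !mxE linearP.
exists W => l A; rewrite WE.
have -> : A = \sum_i \sum_j single l i j (A i j).
  apply/matrixP => a b; rewrite summxE (bigD1 a)//= summxE (bigD1 b)//=.
  rewrite mxE !eqxx/= !big1 ?addr0// => [i ia|j jb].
    by rewrite summxE big1// => j _; rewrite mxE eq_sym (negPf ia).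
  by rewrite mxE [b == j]eq_sym (negPf jb) andbF.
rewrite mxfun_sum; apply: eq_bigr => i _.
rewrite mxfun_sum; apply: eq_bigr => j _.
rewrite mxE gP/=; congr (w l (single l i j _)).
rewrite summxE (bigD1 i)//= summxE (bigD1 j)//= mxE !eqxx/=.
rewrite !big1 ?addr0// => [i' ii|j' jj].
  by rewrite summxE big1// => j' _; rewrite mxE eq_sym (negPf ii).
by rewrite mxE [j == j']eq_sym (negPf jj) andbF.
Qed.

End CoproductElements.

(** * The coproduct of operator systems is an operator system *)

(** A matrix at which all positive functionals vanish is [0]. *)
Lemma positive_functionals_separate (R : realType) (V : matOrdType R) n
    (A : 'M[V]_n) : operator_system V ->
  (forall w : {scalar mxsys V n}, positive_functional w -> w A = 0) -> A = 0.
Proof.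
move=> OS A0; have [H [K [sH sK AE AsE]]] := cartesian A.
have wHK (w : {scalar mxsys V n}) : positive_functional w ->
    w H = 0 /\ w K = 0.
  move=> wp; have e1 : w H + 'i * w K = 0.
    by rewrite -linearZ -linearD -AE; exact: A0.
  have e2 : w H - 'i * w K = 0.
    have := positive_functional_herm OS wp A; rewrite A0// conjC0 AsE.
    by rewrite linearB linearZ.
  have wH : w H = 0.
    have : 2 * w H = 0.
      by rewrite mulr_natl mulr2n -[RHS](addr0 0) -{1}e1 -e2 addrACA subrr addr0.
    by move/eqP; rewrite mulf_eq0 pnatr_eq0/= => /eqP.
  split=> //; move: e1; rewrite wH add0r => /eqP.
  by rewrite mulf_eq0 (negPf (neq0Ci _))/= => /eqP.
have H0 B : starmx B = B ->
    (forall w : {scalar mxsys V n}, positive_functional w -> w B = 0) -> B = 0.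
  move=> sB wB; have pos D : starmx D = D ->
      (forall w : {scalar mxsys V n}, positive_functional w -> w D = 0) -> mpos D.
    move=> sD wD; apply: contrapT => /(state_separation OS sD)[w [_ wp]].
    by rewrite wD// ltxx.
  apply: (mpos_proper OS); first exact: pos.
  by apply: pos => [|w wp]; rewrite ?starmxN ?sB// mxfunN wB// oppr0.
have HE : H = 0 by apply: H0 sH _ => w /wHK[].
have KE : K = 0 by apply: H0 sK _ => w /wHK[].
by rewrite AE HE KE scaler0 addr0.
Qed.

(** Positive maps preserve the adjoint. *)
Lemma positive_map_star (R : realType) (V S : matOrdType R)
    (g : {linear V -> S}) n : operator_system V -> operator_system S ->
  (forall A : 'M[V]_n, mpos A -> mpos (map_mx g A)) ->
  forall A : 'M[V]_n, starmx (map_mx g A) = map_mx g (starmx A).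
Proof.
move=> V_os S_os gp.
have gH (H : 'M[V]_n) : starmx H = H -> starmx (map_mx g H) = map_mx g H.
  move=> sH; have [r r0 [rH _]] := order_unitP V_os sH.
  have := mpos_selfadjoint S_os (gp _ rH).
  rewrite map_mxB starmxB (mpos_selfadjoint S_os (gp _ (mpos_tens1_real V_os _ (ltW r0)))).
  by move=> /addrI/oppr_inj.
move=> A; have [H [K [sH sK -> ->]]] := cartesian A.
have gE (a : R[i]) : map_mx g (H + a *: (K : mxsys V n)) =
    map_mx g H + scale_mx a (map_mx g K).
  by apply/matrixP => i j; rewrite !mxE linearD linearZ.
by rewrite -scaleNr !gE starmxD starmxZ !gH// conjCi.
Qed.

Section CoproductPositivity.
Variables (R : realType) (L : choiceType) (V : L -> matOrdType R) (l0 : L).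
Local Notation C := R[i].
Local Notation emb l := (@oplus1_inj R L V l).
Hypothesis V_os : forall l, operator_system (V l).
(** A completely positive state on each of the systems: it extends functionals
    from the scalar matrices to all matrices. *)
Variable chi : forall l, {scalar V l}.
Hypothesis chi_unit : forall l, chi l (unit_elt (V l)) = 1.
Hypothesis chi_cp : forall l n (A : 'M[V l]_n), mpos A ->
  psdform (fun i j => chi l (A i j)).

(** The functionals that are positive on each of the systems. *)
Definition cofunctional n : set {scalar mxsys (oplus1 V) n} :=
  [set W | forall l (A : 'M[V l]_n), mpos A -> 0 <= W (map_mx (emb l) A)].

Lemma cofunctional_restrict n (W : {scalar mxsys (oplus1 V) n}) l :
  exists w : {scalar mxsys (V l) n},
    forall A, w A = W (map_mx (emb l) (A : 'M_n)).
Proof.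
apply: ex_scalar => a A B; rewrite -mxfunZ -mxfunD; congr (W _).
by apply/matrixP => i j; rewrite !mxE linearP.
Qed.

(** A functional extends from the scalar matrices over [V m] to the matrices over
    [V l]. *)
Lemma extend_functional n l m (w : {scalar mxsys (V m) n}) :
  positive_functional w -> exists2 w' : {scalar mxsys (V l) n},
    positive_functional w' &
    forall A : 'M_n, w' A = w (tens1 (V m) (map_mx (chi l) A)).
Proof.
move=> wp; have [|w' w'E] := @ex_scalar _ (mxsys (V l) n)
    (fun A => w (tens1 (V m) (map_mx (chi l) (A : 'M_n)))).
  move=> a A B; rewrite -mxfunZ -mxfunD; congr (w _).
  by apply/matrixP => i j; rewrite !mxE linearP scalerDl scalerA.
exists w' => // A Ap; rewrite w'E; apply: wp; apply: mpos_tens1_psd => //.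
move=> v; rewrite (_ : qform _ v = qform (fun i j => chi l (A i j)) v).
  exact: chi_cp.
by apply: eq_bigr => i _; apply: eq_bigr => j _; rewrite mxE.
Qed.

(** Compatible positive functionals on the matrices over finitely many of the
    systems extend to the coproduct. *)
Lemma cofunctional_of_family n (F : {fset L}) (m : L)
    (w : forall l, {scalar mxsys (V l) n}) : m \in F ->
  {in F, forall l, positive_functional (w l)} ->
  {in F &, forall l l' a, w l (tens1 (V l) a) = w l' (tens1 (V l') a)} ->
  exists2 W, @cofunctional n W &
    (forall l (A : 'M_n), l \in F -> W (map_mx (emb l) A) = w l A) /\
    (forall l (A : 'M_n), l \notin F ->
      W (map_mx (emb l) A) = w m (tens1 (V m) (map_mx (chi l) A))).
Proof.
move=> mF wp w_eq.
have ext l : exists w' : {scalar mxsys (V l) n}, [/\ positive_functional w',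
    l \in F -> forall A, w' A = w l A &
    l \notin F -> forall A : 'M_n,
      w' A = w m (tens1 (V m) (map_mx (chi l) A))].
  have [lF|lF] := boolP (l \in F).
    by exists (w l); split=> //; exact: wp.
  have [w' w'p w'E] := extend_functional l (wp m mF).
  by exists w'.
pose w' l := sval (cid (ext l)).
have w'p l : positive_functional (w' l) by rewrite /w'; case: cid => ? [].
have w'F l : l \in F -> forall A, w' l A = w l A.
  by rewrite /w'; case: cid => ? [].
have w'nF l : l \notin F -> forall A : 'M_n,
    w' l A = w m (tens1 (V m) (map_mx (chi l) A)).
  by rewrite /w'; case: cid => ? [].
have w'1 l a : w' l (tens1 (V l) a) = w m (tens1 (V m) a).
  have [lF|lF] := boolP (l \in F); first by rewrite w'F// (w_eq l m).
  rewrite w'nF//; congr (w m (tens1 _ _)); apply/matrixP => i j.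
  by rewrite !mxE linearZ/= chi_unit mulr1.
have [|W WE] := @oplus1_mx_universal R L V n w'.
  by move=> l l' a; rewrite !w'1.
exists W; first by move=> l A Ap; rewrite WE; exact: w'p.
by split=> l A lF; rewrite WE; [exact: w'F|exact: w'nF].
Qed.

Lemma cofunctional_extend n m (w : {scalar mxsys (V m) n}) :
  positive_functional w -> exists2 W, @cofunctional n W &
    (forall A : 'M_n, W (map_mx (emb m) A) = w A) /\
    forall l (A : 'M_n), l != m ->
      W (map_mx (emb l) A) = w (tens1 (V m) (map_mx (chi l) A)).
Proof.
move=> wp.
pose u l := sval (cid2 (extend_functional l wp)).
pose w' : forall l, {scalar mxsys (V l) n} := dfwith u m w.
have w'm : w' m = w by exact: dfwithin.
have [|l /fset1P->|l l' /fset1P-> /fset1P->//|W Wc [WF WnF]] :=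
  @cofunctional_of_family n [fset m]%fset m w'.
- exact: fset11.
- by rewrite w'm.
exists W => //; split=> [A|l A lm]; first by rewrite WF ?fset11// w'm.
by rewrite WnF ?inE// w'm.
Qed.

Lemma cofunctional_herm n W (A : 'M[oplus1 V]_n) :
  cofunctional W -> W (starmx A) = (W A)^*.
Proof.
move=> Wc; have [F [x ->]] := oplus1_mx_decomposition A.
have star_sum : starmx (\sum_(l <- F) map_mx (emb l) (x l)) =
    \sum_(l <- F) map_mx (emb l) (starmx (x l)).
  rewrite (big_morph _ (@starmxD _ _ n) (_ : starmx 0 = 0)); last first.
    by apply/matrixP => i j; rewrite !mxE star0.
  by apply: eq_bigr => l _; rewrite map_inj_star.
rewrite star_sum !mxfun_sum rmorph_sum; apply: eq_bigr => l _.
have [w wE] := cofunctional_restrict W l; rewrite -!wE.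
by apply: positive_functional_herm => // B Bp; rewrite wE; exact: Wc.
Qed.

Lemma cofunctional_unit n W : @cofunctional n W ->
  0 <= W (tens1 (oplus1 V) 1%:M).
Proof. by move=> Wc; rewrite -(map_inj_tens1 V l0) Wc//; exact: mpos_tens1_1. Qed.

Lemma cofunctional_cong n m (X : 'M[C]_(n, m)) W : @cofunctional m W ->
  exists2 W', @cofunctional n W' & forall A : 'M_n, W (congmx X A) = W' A.
Proof.
move=> Wc; have [|W' W'E] := @ex_scalar _ (mxsys (oplus1 V) n)
    (fun A => W (congmx X (A : 'M_n))).
  by move=> a A B; rewrite [congmx X _]congmx_is_linear mxfunD mxfunZ.
exists W' => // l A Ap; rewrite W'E map_inj_cong; apply: Wc.
exact: mpos_cong.
Qed.

Lemma cofunctionals_separate n (A : 'M[oplus1 V]_n) :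
  (forall W, cofunctional W -> W A = 0) -> A = 0.
Proof.
move=> A0; have [F [x AE]] := oplus1_mx_decomposition A.
(* Each component [x m] is a scalar matrix, as a functional on [V m] may be
   extended in a way that sees the other components as scalar matrices. *)
have xm m : m \in F -> exists b, x m = tens1 (V m) b.
  move=> mF; pose b := \sum_(l <- (F `\ m)%fset) map_mx (chi l) (x l).
  exists (- b); apply/eqP; rewrite tens1N -addr_eq0; apply/eqP.
  apply: positive_functionals_separate => // w /cofunctional_extend[W Wc [Wm Wl]].
  have := A0 W Wc; rewrite AE mxfun_sum (big_fsetD1 m mF) Wm /= => <-.
  rewrite mxfunD tens1_sum mxfun_sum; congr (_ + _).
  rewrite big_seq [RHS]big_seq; apply: eq_bigr => l.
  by rewrite !inE => /andP[lm _]; rewrite Wl.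
have [b bE] : exists b : L -> 'M[C]_n, forall m, m \in F -> x m = tens1 (V m) (b m).
  have /choice[b bP] : forall m, exists b, m \in F -> x m = tens1 (V m) b.
    move=> m; have [/xm[b xE]|_] := boolP (m \in F); first by exists b.
    by exists 0.
  by exists b.
have AE' : A = tens1 (oplus1 V) (\sum_(l <- F) b l).
  rewrite AE tens1_sum big_seq [RHS]big_seq; apply: eq_bigr => l lF.
  by rewrite bE// map_inj_tens1.
rewrite AE' -(map_inj_tens1 V l0) (_ : tens1 (V l0) _ = 0) ?map_mx0//.
apply: positive_functionals_separate => // w /cofunctional_extend[W Wc [Wm _]].
by rewrite -Wm map_inj_tens1 -AE' A0.
Qed.

Lemma cofunctionals_bounded n (A : 'M[oplus1 V]_n) : starmx A = A ->
  exists2 r : R, 0 < r &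
    forall W, cofunctional W -> W A <= r%:C * W (tens1 (oplus1 V) 1%:M).
Proof.
move=> sA; have [F [x AE]] := oplus1_mx_decomposition A.
have /choice[r rP] : forall l, exists r : R, 0 < r /\
    mpos (tens1 (V l) r%:C%:M - (x l + starmx (x l))).
  move=> l; have [|r r0 rx] := @matrix_order_unit _ _ (V_os l) n (x l + starmx (x l)).
    by rewrite starmxD starmxK addrC.
  by exists r.
have r0 : 0 <= \sum_(l <- F) r l.
  by apply: sumr_ge0 => l _; apply/ltW; exact: (rP l).1.
exists ((\sum_(l <- F) r l) / 2 + 1); first by lra.
move=> W Wc; set c := W (tens1 _ _).
have c0 : 0 <= c := cofunctional_unit Wc.
have WA : W A *+ 2 <= (\sum_(l <- F) r l)%:C * c.
  rewrite mulr2n -{2}[A]sA -mxfunD AE.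
  have -> : (\sum_(l <- F) map_mx (emb l) (x l)) +
      starmx (\sum_(l <- F) map_mx (emb l) (x l)) =
      \sum_(l <- F) map_mx (emb l) (x l + starmx (x l)).
    rewrite (big_morph _ (@starmxD _ _ n) (_ : starmx 0 = 0)); last first.
      by apply/matrixP => i j; rewrite !mxE star0.
    rewrite -big_split/=; apply: eq_bigr => l _.
    by rewrite map_inj_star map_mxD.
  rewrite mxfun_sum rmorph_sum mulr_suml; apply: ler_sum => l _.
  have := Wc l _ (rP l).2; rewrite map_mxB map_inj_tens1 mxfunB subr_ge0.
  by rewrite tens1_scalar mxfunZ.
rewrite rmorphD/= mulrDl mul1r ler_wpDr// rmorphM fmorphV rmorph_nat.
by rewrite mulrAC ler_pdivlMr// mulr_natr.
Qed.

(** Positivity in the coproduct is tested by these functionals: this is the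
    definition, with states replaced by the positive functionals of which they
    are the normalizations. *)
Lemma oplus1_mposP n (A : 'M[oplus1 V]_n) :
  mpos A <-> forall W, cofunctional W -> 0 <= W A.
Proof.
split=> [[F [x [AE Ax]]] W Wc|A0]; last first.
  have [F [x AE]] := oplus1_mx_decomposition A.
  exists F, x; split=> // w ws w_eq.
  have [->|/fset0Pn[m mF]] := eqVneq F fset0; first by rewrite big_seq_fset0.
  have [|W Wc [WF _]] := cofunctional_of_family mF _ w_eq.
    by move=> l lF; exact: (ws l lF).2.
  have := A0 W Wc; rewrite AE mxfun_sum big_seq [X in _ -> 0 <= X]big_seq.
  by under eq_bigr => l lF do rewrite WF//.
have c0 := cofunctional_unit Wc.
pose w l := sval (cid (cofunctional_restrict W l)).
have wE l (B : 'M_n) : w l B = W (map_mx (emb l) B).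
  by move: B; rewrite /w; case: cid.
have wp l : positive_functional (w l) by move=> B Bp; rewrite wE; exact: Wc.
have w1 l : w l (tens1 (V l) 1%:M) = W (tens1 (oplus1 V) 1%:M).
  by rewrite wE map_inj_tens1.
have WA : W A = \sum_(l <- F) w l (x l).
  by rewrite AE mxfun_sum; apply: eq_bigr => l _; rewrite wE.
move: c0 w1; set c := W (tens1 _ _); rewrite le_eqVlt => /predU1P[<- w1|c0 w1].
  by rewrite WA big1// => l _; exact: positive_functional0 (w1 l) _.
have u_ex l : exists u : {scalar mxsys (V l) n}, forall B, u B = c^-1 * w l B.
  apply: ex_scalar => a B D; rewrite linearP mulrDr; congr (_ + _).
  by rewrite mulrCA.
pose u l := sval (cid (u_ex l)).
have uE l B : u l B = c^-1 * w l B by rewrite /u; case: cid.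
have := Ax u _ _; under eq_bigr => l _ do rewrite uE.
rewrite -mulr_sumr -WA pmulr_rge0 ?invr_gt0//; apply.
  move=> l lF; split; first by rewrite uE w1 mulVf// gt_eqF.
  by move=> B Bp; rewrite uE mulr_ge0 ?invr_ge0 ?(ltW c0)//; exact: wp.
by move=> l m lF mF a; rewrite !uE !wE !map_inj_tens1.
Qed.

Theorem oplus1_operator_system : operator_system (oplus1 V).
Proof.
apply: (@operator_system_functionals _ _ (@cofunctional)).
- by move=> n A; exact: oplus1_mposP.
- by move=> n w A; exact: cofunctional_herm.
- by move=> n w; exact: cofunctional_unit.
- by move=> n A; exact: cofunctionals_separate.
- by move=> n m X w; exact: cofunctional_cong.
- by move=> n A; exact: cofunctionals_bounded.
Qed.

Lemma oplus1_inj_mpos n l (A : 'M[V l]_n) : mpos A -> mpos (map_mx (emb l) A).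
Proof. by move=> Ap; apply/oplus1_mposP => W Wc; exact: Wc. Qed.

(** A map out of the coproduct is completely positive if it is so on each of the
    systems: a state that detects a failure of positivity pulls back to a
    functional in [cofunctional]. *)
Lemma oplus1_map_cp (S : matOrdType R) (f : {linear oplus1 V -> S}) :
  operator_system S ->
  (forall l n (A : 'M[V l]_n), mpos A -> mpos (map_mx f (map_mx (emb l) A))) ->
  completely_positive f.
Proof.
move=> S_os fp n A Ap.
have f_star : starmx (map_mx f A) = map_mx f (starmx A).
  have [F [x ->]] := oplus1_mx_decomposition A.
  have map_f_sum (y : forall l, 'M[V l]_n) :
      map_mx f (\sum_(l <- F) map_mx (emb l) (y l)) =
      \sum_(l <- F) map_mx f (map_mx (emb l) (y l)).
    by apply: (big_morph (map_mx f)); [exact: map_mxD|exact: map_mx0].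
  rewrite map_f_sum.
  rewrite !(big_morph _ (@starmxD _ _ n) (_ : starmx 0 = 0)); try by
    apply/matrixP => i j; rewrite !mxE star0.
  under [X in _ = map_mx f X]eq_bigr => l _ do rewrite map_inj_star.
  rewrite map_f_sum.
  apply: eq_bigr => l _.
  have compE (B : 'M[V l]_n) :
      map_mx (f \o emb l) B = map_mx f (map_mx (emb l) B).
    exact: map_mx_comp.
  have := @positive_map_star _ _ _ (f \o emb l) n (V_os l) S_os _ (x l).
  by rewrite !compE; apply=> B /fp; rewrite compE.
apply: contrapT => nA.
have [|w [_ wp] wA] := state_separation S_os _ nA.
  by rewrite f_star (mpos_selfadjoint oplus1_operator_system Ap).
have [|W WE] := @ex_scalar _ (mxsys (oplus1 V) n)
    (fun B => w (map_mx f (B : 'M_n))).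
  move=> a B D; rewrite -mxfunZ -mxfunD; congr (w _).
  by apply/matrixP => i j; rewrite !mxE linearP.
have Wc : cofunctional W by move=> l B Bp; rewrite WE; apply: wp; exact: fp.
have := (oplus1_mposP A).1 Ap W Wc; rewrite WE => wA'.
by have := le_lt_trans wA' wA; rewrite ltxx.
Qed.

End CoproductPositivity.

(** * The norm of a positive element *)

Section Norm.
Variables (R : realType) (V : matOrdType R).
Local Notation C := R[i].

(** [X^* A Y] for rectangular [X] and [Y]. *)
Let cong2 n m p (X : 'M[C]_(n, m)) (Y : 'M[C]_(n, p)) (A : 'M[V]_n) : 'M_(m, p) :=
  \matrix_(i, j) \sum_k \sum_l (((X k i)^* * Y l j) *: A k l).

Let cong2_11 n (A : 'M[V]_n) : cong2 1%:M 1%:M A = A.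
Proof.
apply/matrixP => i j; rewrite mxE (bigD1 i)//= (bigD1 j)//= !mxE !eqxx.
rewrite conjC1 mulr1 scale1r !big1 ?addr0// => [k ki|l lj].
  by rewrite big1// => l _; rewrite !mxE (negPf ki) conjC0 mul0r scale0r.
by rewrite !mxE (negPf lj) mulr0 scale0r.
Qed.

Let cong2_0l n m p (Y : 'M[C]_(n, p)) A : cong2 (0 : 'M_(n, m)) Y A = 0.
Proof.
apply/matrixP => i j; rewrite !mxE big1// => k _; rewrite big1// => l _.
by rewrite mxE conjC0 mul0r scale0r.
Qed.

Let cong2_0r n m p (X : 'M[C]_(n, m)) A : cong2 X (0 : 'M_(n, p)) A = 0.
Proof.
apply/matrixP => i j; rewrite !mxE big1// => k _; rewrite big1// => l _.
by rewrite mxE mulr0 scale0r.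
Qed.

Let congmx_row n m p (X : 'M[C]_(n, m)) (Y : 'M[C]_(n, p)) (A : 'M[V]_n) :
  congmx (row_mx X Y) A =
  block_mx (cong2 X X A) (cong2 X Y A) (cong2 Y X A) (cong2 Y Y A).
Proof.
apply/matrixP => i j; rewrite mxE.
by case: (split_ordP i) => i' ->; case: (split_ordP j) => j' ->;
  rewrite ?block_mxEul ?block_mxEur ?block_mxEdl ?block_mxEdr mxE;
  apply: eq_bigr => k _; apply: eq_bigr => l _; rewrite ?row_mxEl ?row_mxEr.
Qed.

Let congmx_block n (A B D E : 'M[V]_n) :
  congmx (col_mx 1%:M (- 1%:M)) (block_mx A B D E) = A - B - D + E.
Proof.
have c2N (X Y : 'M[C]_n) (F : 'M[V]_n) :
    (cong2 X (- Y) F = - cong2 X Y F) * (cong2 (- X) Y F = - cong2 X Y F).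
  split; apply/matrixP => i j; rewrite !mxE -sumrN; apply: eq_bigr => k _;
  rewrite -sumrN; apply: eq_bigr => l _; rewrite !mxE.
    by rewrite mulrN scaleNr.
  by rewrite rmorphN mulNr scaleNr.
transitivity (cong2 1%:M 1%:M A + cong2 1%:M (- 1%:M) B +
    cong2 (- 1%:M) 1%:M D + cong2 (- 1%:M) (- 1%:M) E); last first.
  by rewrite !c2N !cong2_11 opprK.
have addE (M N : 'M[V]_n) i j : (M + N) i j = M i j + N i j by rewrite mxE.
apply/matrixP => i j; rewrite !addE !mxE big_split_ord/=.
under eq_bigr => k _ do rewrite big_split_ord/=.
under [X in _ + X = _]eq_bigr => k _ do rewrite big_split_ord/=.
rewrite !big_split/= addrA; congr (_ + _ + _ + _);
  apply: eq_bigr => k _; apply: eq_bigr => l _;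
  by rewrite ?(col_mxEu, col_mxEd, block_mxEul, block_mxEur, block_mxEdl,
    block_mxEdr).
Qed.

Hypothesis OS : operator_system V.

(** If [0 <= A <= r], then the block matrix that defines the norm is the sum of
    [r - A] on the diagonal and of [A] in all four blocks. *)
Lemma mpos_block n (r : R) (A : 'M[V]_n) :
  mpos A -> mpos (tens1 V r%:C%:M - A) ->
  mpos (block_mx (tens1 V r%:C%:M) A (starmx A) (tens1 V r%:C%:M)).
Proof.
move=> Ap rA; rewrite (mpos_selfadjoint OS Ap).
have -> : block_mx (tens1 V r%:C%:M) A A (tens1 V r%:C%:M) =
    congmx (row_mx 1%:M 0) (tens1 V r%:C%:M - A) +
    congmx (row_mx 0 1%:M) (tens1 V r%:C%:M - A) +
    congmx (row_mx 1%:M 1%:M) A.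
  rewrite !congmx_row !cong2_11 !cong2_0r !cong2_0l !add_block_mx.
  by rewrite !add0r !addr0 subrK.
by apply: (mposD OS); [apply: (mposD OS)|]; exact: (mpos_cong OS).
Qed.

Lemma opnorm_le n (r : R) (A : 'M[V]_n) : 0 <= r -> mpos A ->
  mpos (tens1 V r%:C%:M - A) -> opnorm A <= r.
Proof.
move=> r0 Ap rA; apply: ge_inf; last by split=> //; exact: mpos_block.
by exists 0 => s [].
Qed.

(** Together with [opnorm_le]: the norm of a positive [A] is the least [r >= 0]
    such that [A <= r].  The bound on [A] is a compression by [(1, -1)] of the
    block matrix that defines the norm. *)
Lemma opnorm_pos n (A : 'M[V]_n) : mpos A ->
  0 <= opnorm A /\ mpos (tens1 V (opnorm A)%:C%:M - A).
Proof.
move=> Ap; have sA := mpos_selfadjoint OS Ap.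
set E := [set r : R | 0 <= r /\
  mpos (block_mx (tens1 V r%:C%:M) A (starmx A) (tens1 V r%:C%:M))].
have E0 : E !=set0.
  have [r r0 rA] := matrix_order_unit OS sA.
  by exists r; split; [exact: ltW|exact: mpos_block].
have lE : has_lbound E by exists 0 => s [].
split; first by apply: lb_le_inf => // s [].
apply: (mpos_archimedean OS) => e e0.
have [r [r0 rA] re] := @inf_adherent _ E e e0 (conj E0 lE).
rewrite addrA -tens1D -raddfD/= -rmorphD/=.
apply: (@mpos_le _ _ OS _ r); first by rewrite addrC ltW.
apply: (@mposZ_gt0 _ _ OS _ 2) => //.
have := mpos_cong OS (col_mx 1%:M (- 1%:M)) rA.
rewrite congmx_block sA; congr mpos; apply/matrixP => i j.
by rewrite !mxE rmorph_nat scaler_nat mulr2n addrAC -!addrA; congr (_ + _);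
  rewrite addrCA.
Qed.

Lemma opnorm0_le n : opnorm (0 : 'M[V]_n) <= 0.
Proof.
apply: opnorm_le => //; first exact: (mpos0 OS).
by rewrite subr0; exact: (mpos_tens1_real OS).
Qed.

Lemma opnorm_eq0 n (A : 'M[V]_n) : mpos A -> opnorm A = 0 -> A = 0.
Proof.
move=> Ap A0; have [_] := opnorm_pos Ap; rewrite A0 => nA.
apply: (mpos_proper OS) => //; suff <- : tens1 V 0%:C%:M - A = - A by [].
by rewrite raddf0; apply/matrixP => i j; rewrite !mxE scale0r sub0r.
Qed.

End Norm.

(** * Maps from the affine matrix-valued functions *)

Section ChoiMaps.
Variables (R : realType) (S : matOrdType R).
Hypothesis S_os : operator_system S.
Local Notation C := R[i].
Local Notation U := (unit_interval R).

(** Choi's theorem: if [P] is positive, then [e_ab |-> P_ab] is completely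
    positive, as a positive semidefinite [Q] is a sum of rank one matrices. *)
Lemma choi_mpos k n (P : 'M[S]_k) (Q : 'I_n * 'I_k -> 'I_n * 'I_k -> C) :
  mpos P -> psdform Q ->
  mpos (\matrix_(i, j) \sum_a \sum_b Q (i, a) (j, b) *: P a b : 'M[S]_n).
Proof.
move=> Pp /psdform_gram[m [Y QE]].
rewrite (_ : \matrix_(i, j) _ =
    \sum_r congmx (\matrix_(a, i) Y r (i, a)) P); last first.
  apply/matrixP => i j; rewrite summxE mxE.
  under eq_bigr => a _.
    under eq_bigr => b _ do rewrite QE scaler_suml.
    rewrite exchange_big/=; over.
  rewrite exchange_big/=; apply: eq_bigr => r _; rewrite mxE.
  by apply: eq_bigr => a _; apply: eq_bigr => b _; rewrite !mxE.
by apply: mpos_sum => // r _; exact: mpos_cong.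
Qed.

Fact unit_interval0_subproof : (0 : R) \in `[(0 : R), 1]%classic.
Proof. by apply/mem_set; rewrite /= in_itv/= lexx ler01. Qed.
Fact unit_interval1_subproof : (1 : R) \in `[(0 : R), 1]%classic.
Proof. by apply/mem_set; rewrite /= in_itv/= lexx ler01. Qed.
Definition unit_interval0 : U := SigSub unit_interval0_subproof.
Definition unit_interval1 : U := SigSub unit_interval1_subproof.

(** The values at the endpoints identify the affine functions with the direct
    sum of two matrix algebras, so two positive matrices define a map. *)
Definition choi_map k (P0 P1 : 'M[S]_k) (F : frakC R k) : S :=
  \sum_a \sum_b (fev unit_interval0 F a b *: P0 a b +
                 fev unit_interval1 F a b *: P1 a b).

Lemma choi_map_linear k (P0 P1 : 'M[S]_k) : linear (choi_map P0 P1).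
Proof.
move=> x F G; rewrite /choi_map scaler_sumr -big_split/=.
apply: eq_bigr => a _; rewrite scaler_sumr -big_split/=; apply: eq_bigr => b _.
rewrite !fev_linear !scalerDl scalerDr !scalerA.
by rewrite -!addrA; congr (_ + _); rewrite addrCA.
Qed.

Lemma choi_map_unit k (P0 P1 : 'M[S]_k) :
  choi_map P0 P1 (unit_elt (frakC R k)) = \sum_a (P0 a a + P1 a a).
Proof.
apply: eq_bigr => a _; rewrite (bigD1 a)//= !fev_unit eqxx !scale1r.
rewrite big1 ?addr0// => b ba.
by rewrite !fev_unit eq_sym (negPf ba) !scale0r addr0.
Qed.

Lemma choi_map_cp k n (P0 P1 : 'M[S]_k) (A : 'M[frakC R k]_n) :
  mpos P0 -> mpos P1 -> mpos A -> mpos (map_mx (choi_map P0 P1) A).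
Proof.
move=> P0p P1p /frakC_mpos Ap.
have := mposD S_os (choi_mpos P0p (Ap unit_interval0))
                   (choi_mpos P1p (Ap unit_interval1)).
congr mpos; apply/matrixP => i j; rewrite !mxE -big_split/=.
by apply: eq_bigr => a _; rewrite -big_split.
Qed.

(** The matrix with [s] in the top left corner and [0] elsewhere. *)
Definition corner_mx k (s : S) : 'M[S]_k.+1 :=
  \matrix_(a, b) (if (a == ord0) && (b == ord0) then s else 0).

Lemma mpos_corner k (s : S) : pos_elt s -> mpos (corner_mx k s).
Proof.
move=> /(mpos_cong S_os (delta_mx ord0 ord0 : 'M_(1, k.+1))).
congr mpos; apply/matrixP => a b; rewrite !mxE !big_ord1 !mxE !eqxx/=.
by do 2 case: eqP => _ /=; rewrite ?conjC1 ?conjC0 ?mul0r ?mulr0 ?mulr1 ?scale1r ?scale0r.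
Qed.

Lemma corner_trace k (s : S) :
  \sum_a corner_mx k s a a = s.
Proof.
rewrite (bigD1 ord0)//= mxE big1 ?addr0// => a a0.
by rewrite mxE (negPf a0).
Qed.

End ChoiMaps.

Section UniversalLift.
Variables (R : realType) (k : nat).
Local Notation C := R[i].
Local Notation U := (unit_interval R).

(** The function [e_ab (x) t]. *)
Definition coord_unit (a b : 'I_k) : frakC R k :=
  exist _ (elem_tens a b (coordinate R))
    (mem_span (or_intror (ex_intro _ a (ex_intro _ b erefl)))).

Lemma fev_coord_unit (t : U) a b c d :
  fev t (coord_unit a b) c d = (val t)%:C * ((c == a) && (d == b))%:R.
Proof.
by rewrite /fev /= mxE; case: ifP => _; rewrite ?mulr1 ?mulr0.
Qed.

Lemma choi_map_coord_unit (S : matOrdType R) (P0 P1 : 'M[S]_k) a b :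
  choi_map P0 P1 (coord_unit a b) = P1 a b.
Proof.
rewrite /choi_map (bigD1 a)//= (bigD1 b)//= !fev_coord_unit !eqxx/=.
rewrite mul0r scale0r mul1r scale1r add0r !big1 ?addr0// => [c ca|d db].
  rewrite big1// => d _; rewrite !fev_coord_unit (negPf ca)/=.
  by rewrite !mulr0 !scale0r addr0.
by rewrite !fev_coord_unit (negPf db) andbF !mulr0 !scale0r addr0.
Qed.

(** The matrix of the [e_ab (x) t]. *)
Definition coord_matrix : 'M[frakC R k]_k := \matrix_(a, b) coord_unit a b.

(** The matrix [(e_ab)_ab] has rank one, so the form is [t] times a square. *)
Lemma coord_matrix_form (t : U) (v : 'I_k * 'I_k -> C) :
  frakC_form t v coord_matrix = (val t)%:C * `|\sum_a v (a, a)| ^+ 2.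
Proof.
rewrite /frakC_form /qform.
transitivity (\sum_(p : 'I_k * 'I_k | p.1 == p.2) \sum_(q | q.1 == q.2)
    (v p)^* * (val t)%:C * v q).
  rewrite [RHS]big_mkcond/=; apply: eq_bigr => p _.
  case: eqP => [p12|/eqP p12]; last first.
    rewrite big1// => q _; rewrite mxE fev_coord_unit eq_sym (negPf p12)/=.
    by rewrite !mulr0 mul0r.
  rewrite [RHS]big_mkcond/=; apply: eq_bigr => q _.
  rewrite mxE fev_coord_unit p12 eqxx/= eq_sym; case: eqP => _.
    by rewrite mulr1.
  by rewrite !mulr0 mul0r.
have diag (F : 'I_k * 'I_k -> C) :
    \sum_(p : 'I_k * 'I_k | p.1 == p.2) F p = \sum_a F (a, a).
  rewrite big_mkcond (eq_bigr (fun p => if p.1 == p.2 then F (p.1, p.2) else 0)).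
    rewrite -(pair_bigA _ (fun a b => if a == b then F (a, b) else 0))/=.
    apply: eq_bigr => a _; rewrite (bigD1 a)//= eqxx big1 ?addr0// => b ba.
    by rewrite eq_sym (negPf ba).
  by case.
rewrite diag; under eq_bigr => a _ do rewrite diag -mulr_sumr.
rewrite -mulr_suml normCK rmorph_sum.
by under eq_bigr => a _ do rewrite mulrC; rewrite -mulr_sumr -mulrA [X in _ * X]mulrC.
Qed.

Lemma coord_matrix_mpos : mpos coord_matrix.
Proof.
apply/frakC_mpos => t v; rewrite -/(frakC_form t v _) coord_matrix_form.
apply: mulr_ge0; last exact: exprn_ge0.
have /andP[t0 _] : 0 <= val t <= 1 by have := set_valP t; rewrite /= in_itv.
by rewrite ler0c.
Qed.

(** The norm bound rests on the Cauchy-Schwarz inequality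
    [|v_1 + .. + v_k|^2 <= k (|v_1|^2 + .. + |v_k|^2)]. *)
Lemma coord_matrix_le : mpos (tens1 (frakC R k) (k%:R : R)%:C%:M - coord_matrix).
Proof.
apply/frakC_mpos => t v; rewrite -/(frakC_form t v _).
have [w wE] := ex_scalar (frakC_form_scalar t v).
rewrite -wE mxfunB !wE tens1_scalar -wE mxfunZ !wE frakC_form_unit.
rewrite coord_matrix_form subr_ge0.
have /andP[t0 t1] : 0 <= val t <= 1 by have := set_valP t; rewrite /= in_itv.
apply: (@le_trans _ _ (`|\sum_a v (a, a)| ^+ 2)).
  by rewrite ler_piMl ?exprn_ge0// (_ : 1 = 1%:C) ?lecR.
have -> : `|\sum_a v (a, a)| ^+ 2 = `|qform (fun=> fun=> 1) (fun a => v (a, a))|.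
  rewrite (_ : qform _ _ = (\sum_a v (a, a))^* * \sum_a v (a, a)); last first.
    rewrite rmorph_sum mulr_suml; apply: eq_bigr => a _.
    by rewrite mulr_sumr; apply: eq_bigr => b _; rewrite mulr1.
  by rewrite normrM norm_conjC.
apply: le_trans (@qform_bound _ _ _ _ 1 ler01 _) _.
  by move=> p q; rewrite normr1.
rewrite mulr1 card_ord rmorph_nat ler_wpM2l ?ler0n//.
have -> : \sum_p `|v p| ^+ 2 = \sum_a \sum_b `|v (a, b)| ^+ 2.
  by rewrite pair_bigA; apply: eq_bigr; case.
apply: ler_sum => a _; rewrite (bigD1 a)//= lerDl.
by apply: sumr_ge0 => b _; exact: exprn_ge0.
Qed.

End UniversalLift.

(** * Infinite sets are equipotent to their squares *)

(** Comparability of the cardinals of two sets. *)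
Lemma injection_total (T : choiceType) (X Y : set T) :
  (exists f : T -> T, set_inj X f /\ set_fun X Y f) \/
  (exists g : T -> T, set_inj Y g /\ set_fun Y X g).
Proof.
pose P (G : set (T * T)) := [/\ forall x y, G (x, y) -> X x /\ Y y,
  forall x y y', G (x, y) -> G (x, y') -> y = y' &
  forall x x' y, G (x, y) -> G (x', y) -> x = x'].
have [F FP totF|G [[GXY Gf Gi] Gmax]] := @Zorn_bigcup _ P.
  split=> [x y [G FG Gxy]|x y y' [G FG Gxy] [G' FG' Gxy']|
           x x' y [G FG Gxy] [G' FG' Gxy']].
  - by have [+ _ _] := FP _ FG; apply; exact: Gxy.
  - have [GG'|GG'] := totF _ _ FG FG'.
      by have [_ + _] := FP _ FG' => /(_ x y y'); apply=> //; exact: GG'.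
    by have [_ + _] := FP _ FG => /(_ x y y'); apply=> //; exact: GG'.
  - have [GG'|GG'] := totF _ _ FG FG'.
      by have [_ _ +] := FP _ FG' => /(_ x x' y); apply=> //; exact: GG'.
    by have [_ _ +] := FP _ FG => /(_ x x' y); apply=> //; exact: GG'.
have [Xtot|] := pselect (forall x, X x -> exists y, G (x, y)).
  left; exists (fun x => xget x [set y | G (x, y)]).
  have fP x : X x -> G (x, xget x [set y | G (x, y)]).
    by move=> /Xtot[y Gxy]; exact: (@xgetI _ x [set y | G (x, y)] y).
  split=> [x x' /set_mem Xx /set_mem Xx' e|x Xx]; last first.
    by have /GXY[] := fP x Xx.
  by apply: Gi (fP _ Xx) _; rewrite e; exact: fP.
move=> /existsNP[x0 /not_implyP[Xx0 nx0]].
have [Ytot|] := pselect (forall y, Y y -> exists x, G (x, y)).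
  right; exists (fun y => xget y [set x | G (x, y)]).
  have fP y : Y y -> G (xget y [set x | G (x, y)], y).
    by move=> /Ytot[x Gxy]; exact: (@xgetI _ y [set x | G (x, y)] x).
  split=> [x x' /set_mem Xx /set_mem Xx' e|x Xx]; last first.
    by have /GXY[] := fP x Xx.
  by apply: Gf (fP _ Xx) _; rewrite e; exact: fP.
move=> /existsNP[y0 /not_implyP[Yy0 ny0]].
have [] := Gmax (G `|` [set (x0, y0)]).
  split; first exact: subsetUl.
  by move=> /(_ (x0, y0)) G0; apply: nx0; exists y0; apply: G0; right.
split=> [x y [/GXY//|[-> ->]//]|x y y' [h|[xE yE]] [h'|[x'E y'E]]|
         x x' y [h|[xE yE]] [h'|[x'E y'E]]].
- exact: Gf h h'.
- by case: nx0; exists y; rewrite -x'E.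
- by case: nx0; exists y'; rewrite -xE.
- by rewrite yE y'E.
- exact: Gi h h'.
- by case: ny0; exists x; rewrite -y'E.
- by case: ny0; exists x'; rewrite -yE.
- by rewrite xE x'E.
Qed.

(** The set [D], for the graph [G] of an injection of [D * D] into [D]. *)
Definition self_pairing_dom (T : Type) (G : set (T * T * T)) : set T :=
  [set a | exists c, G (a, a, c)].

(** [G] is the graph of an injection of [D * D] into [D], for some [D]. *)
Definition self_pairing (T : Type) (G : set (T * T * T)) : Prop :=
  let D := self_pairing_dom G in
  [/\ forall a b, (exists c, G (a, b, c)) <-> D a /\ D b,
      forall a b c c', G (a, b, c) -> G (a, b, c') -> c = c',
      forall a b a' b' c, G (a, b, c) -> G (a', b', c) -> (a, b) = (a', b') &
      forall a b c, G (a, b, c) -> D c].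

Lemma self_pairing_bigcup (T : Type) (F : set (set (T * T * T))) :
  F `<=` @self_pairing T -> total_on F subset ->
  self_pairing (\bigcup_(G in F) G).
Proof.
move=> FP totF.
have up G G' : F G -> F G' -> exists G'', [/\ F G'', G `<=` G'' & G' `<=` G''].
  move=> FG FG'; have [s|s] := totF _ _ FG FG'; [exists G'|exists G].
    by split.
  by split.
split=> [a b|a b c c' [G FG h] [G' FG' h']|a b a' b' c [G FG h] [G' FG' h']|
         a b c [G FG h]].
- split=> [[c [G FG h]]|[[c [G FG h]] [c' [G' FG' h']]]].
    have [+ _ _ _] := FP _ FG => /(_ a b)[+ _].
    by move=> /(_ (ex_intro _ c h))[[d ?] [e ?]]; split; [exists d, G|exists e, G].
  have [G'' [FG'' s s']] := up _ _ FG FG'.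
  have [+ _ _ _] := FP _ FG'' => /(_ a b)[_ +].
  case=> [|d hd]; last by exists d, G''.
  by split; [exists c; exact: s|exists c'; exact: s'].
- have [G'' [FG'' s s']] := up _ _ FG FG'.
  by have [_ + _ _] := FP _ FG'' => /(_ a b); apply; [exact: s|exact: s'].
- have [G'' [FG'' s s']] := up _ _ FG FG'.
  by have [_ _ + _] := FP _ FG'' => /(_ a b a' b' c); apply;
    [exact: s|exact: s'].
- have [_ _ _ /(_ a b c h)[d hd]] := FP _ FG; by exists d, G.
Qed.

Section SelfPairing.
Variables (T : choiceType) (G : set (T * T * T)).
Hypothesis Gp : self_pairing G.
Let D := self_pairing_dom G.

(** The injection with graph [G], with an irrelevant value outside [D * D]. *)
Definition pairing_fun (a b : T) : T := xget a [set c | G (a, b, c)].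

Lemma pairing_funP a b : D a -> D b -> G (a, b, pairing_fun a b).
Proof.
move=> Da Db; have [+ _ _ _] := Gp => /(_ a b)[_ /(_ (conj Da Db))[c Gc]].
exact: (@xgetI _ a [set c | G (a, b, c)] c).
Qed.

Lemma pairing_fun_dom a b : D a -> D b -> D (pairing_fun a b).
Proof.
move=> Da Db; have [_ _ _ +] := Gp; apply; exact: pairing_funP.
Qed.

Lemma pairing_fun_inj a b a' b' : D a -> D b -> D a' -> D b' ->
  pairing_fun a b = pairing_fun a' b' -> (a, b) = (a', b').
Proof.
move=> Da Db Da' Db' e; have [_ _ + _] := Gp; apply.
  exact: pairing_funP.
by rewrite e; exact: pairing_funP.
Qed.

(** [D] and a disjoint set [U] that injects into [D] inject jointly. *)
Lemma joint_injection (d0 d1 : T) (U : set T) (u : T -> T) :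
  D d0 -> D d1 -> d0 <> d1 -> set_inj U u -> set_fun U D u ->
  (forall a, U a -> ~ D a) ->
  exists k : T -> T, set_inj (D `|` U) k /\ set_fun (D `|` U) D k.
Proof.
move=> D0 D1 d01 iu fu UD.
pose k a := if pselect (D a) then pairing_fun d0 a else pairing_fun d1 (u a).
have kD a : D a -> k a = pairing_fun d0 a by rewrite /k; case: pselect.
have kU a : U a -> k a = pairing_fun d1 (u a).
  by move=> /UD; rewrite /k; case: pselect.
exists k; split=> [a b /set_mem + /set_mem|a [Da|Ua]]; last first.
- by rewrite kU//; apply: pairing_fun_dom => //; exact: fu.
- by rewrite kD//; exact: pairing_fun_dom.
have fU c : U c -> D (u c) by move=> /fu.
case=> [Da|Ua] [Db|Ub].
- by rewrite !kD// => /(pairing_fun_inj D0 Da D0 Db)[].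
- by rewrite kD// kU// => /(pairing_fun_inj D0 Da D1 (fU _ Ub))[].
- by rewrite kU// kD// => /(pairing_fun_inj D1 (fU _ Ua) D0 Db)[/esym].
- rewrite !kU// => /(pairing_fun_inj D1 (fU _ Ua) D1 (fU _ Ub))[e].
  by apply: iu => //; exact: mem_set.
Qed.

(** A self-pairing on [D] is not maximal if [D] injects into its complement. *)
Lemma self_pairing_extend (d0 d1 : T) (g : T -> T) :
  D d0 -> D d1 -> d0 <> d1 -> set_inj D g -> set_fun D (~` D) g ->
  exists G', self_pairing G' /\ G `<` G'.
Proof.
move=> D0 D1 d01 ig fg; pose Y := g @` D.
pose u y := xget y [set d | D d /\ g d = y].
have uP y : Y y -> D (u y) /\ g (u y) = y.
  move=> [d Dd gd]; exact: (@xgetI _ y [set d | D d /\ g d = y] d).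
have YD a : Y a -> ~ D a by move=> [d Dd <-]; exact: fg.
have [k [ik fk]] : exists k : T -> T,
    set_inj (D `|` Y) k /\ set_fun (D `|` Y) D k.
  apply: (@joint_injection d0 d1 Y u) => // [y y' /set_mem Yy /set_mem Yy' e|].
    by rewrite -(uP y Yy).2 e (uP y' Yy').2.
  by move=> y /uP[].
pose E := [set t : T * T * T | [/\ (D `|` Y) t.1.1, (D `|` Y) t.1.2,
  ~ (D t.1.1 /\ D t.1.2) & t.2 = g (pairing_fun (k t.1.1) (k t.1.2))]].
have EY a b c : E (a, b, c) -> Y c.
  by move=> [/= Da Db _ ->]; exists (pairing_fun (k a) (k b)) => //;
    apply: pairing_fun_dom; exact: fk.
have [G1 G2 G3 G4] := Gp.
have domE : self_pairing_dom (G `|` E) = D `|` Y.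
  apply/seteqP; split=> [a [c [h|[]//]]|a].
    by left; exists c.
  move=> [[c h]|Ya]; first by exists c; left.
  exists (g (pairing_fun (k a) (k a))); right; split=> //=; try by right.
  by move=> [/(YD _ Ya)].
exists (G `|` E); split.
  split; rewrite ?domE.
  - move=> a b; split=> [[c [h|[]//]]|[Da Db]].
      have /G1[Da Db] : exists c, G (a, b, c) by exists c.
      by split; left.
    have [DD|nDD] := pselect (D a /\ D b).
      by have /G1[c] := DD; exists c; left.
    by exists (g (pairing_fun (k a) (k b))); right.
  - move=> a b c c' [h|h] [h'|h'].
    + exact: G2 h h'.
    + by case: h' => _ _ []; apply/G1; exists c.
    + by case: h => _ _ []; apply/G1; exists c'.
    + by case: h h' => /= _ _ _ -> [/= _ _ _ ->].
  - move=> a b a' b' c [h|h] [h'|h'].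
    + exact: G3 h h'.
    + by have /YD[] := EY _ _ _ h'; exact: G4 h.
    + by have /YD[] := EY _ _ _ h; exact: G4 h'.
    + case: h h' => /= Da Db _ -> [/= Da' Db' _] e.
      have [ea eb] : (k a, k b) = (k a', k b').
        apply: pairing_fun_inj; try exact: fk.
        by apply: ig e; apply/mem_set; apply: pairing_fun_dom; exact: fk.
      by congr (_, _); apply: ik => //; exact: mem_set.
  - by move=> a b c [h|/EY]; [left; exact: G4 h|right].
split; first exact: subsetUl.
have Y0 : Y (g d0) by exists d0.
have Dk : D (k (g d0)) by apply: fk; right.
pose c := pairing_fun (k (g d0)) (k (g d0)) => s.
have /G4 : G (g d0, g d0, g c).
  by apply: s; right; split=> /=; [right|right|move=> [/(YD _ Y0)]|].
by apply: fg; exact: pairing_fun_dom.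
Qed.

End SelfPairing.

Lemma infinite_square_injection (T : choiceType) (e : nat -> T) : injective e ->
  exists p : T -> T -> T,
    forall a b a' b', p a b = p a' b' -> a = a' /\ b = b'.
Proof.
move=> ie.
pose G0 := [set t : T * T * T | exists m n, t = (e m, e n, e (choice.pickle (m, n)))].
have G0p : self_pairing G0.
  have dom0 m : self_pairing_dom G0 (e m).
    by exists (e (choice.pickle (m, m))), m, m.
  split=> [a b|a b c c' [m [n [-> -> ->]]] [m' [n' [/ie-> /ie-> ->]]]//|
      a b a' b' c [m [n [-> -> ->]]] [m' [n' [-> -> /ie]]]|
      a b c [m [n [_ _ ->]]]//].
    split=> [[c [m [n [-> -> _]]]]|[[c [m [n [-> _ _]]]] [d [m' [n' [-> _ _]]]]]].
      by split; exact: dom0.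
    by exists (e (choice.pickle (m, m'))), m, m'.
  by move=> /(pcan_inj choice.pickleK)[-> ->].
have [F FP totF|G [Gp Gmax]] :=
    @Zorn_bigcup _ [set G | self_pairing (G0 `|` G)].
  have [->|/set0P[G1 FG1]] := eqVneq F set0.
    by rewrite /= bigcup_set0 setU0.
  rewrite /= (_ : _ `|` _ = \bigcup_(G in [set G0 `|` G | G in F]) G).
    apply: self_pairing_bigcup => [_ [G FG <-]|_ _ [G FG <-] [G' FG' <-]].
      exact: FP.
    by have [s|s] := totF _ _ FG FG'; [left|right]; exact: setUS.
  rewrite bigcup_image; apply/seteqP; split=> t.
    by move=> [h|[G FG h]]; [exists G1 => //; left|exists G => //; right].
  by move=> [G FG [h|h]]; [left|right; exists G].
set H := G0 `|` G in Gp; pose D := self_pairing_dom H.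
have D0 : D (e 0%N) by exists (e (choice.pickle (0%N, 0%N))); left; exists 0%N, 0%N.
have D1 : D (e 1%N) by exists (e (choice.pickle (1%N, 1%N))); left; exists 1%N, 1%N.
have e01 : e 0%N <> e 1%N by move=> /ie.
have [[g [ig fg]]|[g [ig fg]]] := injection_total D (~` D).
  have [H' [H'p HH']] := self_pairing_extend Gp D0 D1 e01 ig fg.
  have [] := Gmax H'.
  - split; first by apply: subset_trans HH'.1; exact: subsetUr.
    by move=> H'G; apply: HH'.2; apply: subset_trans H'G _; exact: subsetUr.
  - rewrite /= (_ : _ `|` _ = H')//; apply/setUidr.
    by apply: subset_trans HH'.1; exact: subsetUl.
have [k [ik fk]] : exists k : T -> T, set_inj (D `|` ~` D) k /\
    set_fun (D `|` ~` D) D k.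
  exact: (@joint_injection _ _ Gp _ _ _ g D0 D1).
have fkT a : D (k a) by apply: fk; rewrite setUv.
exists (fun a b => pairing_fun H (k a) (k b)) => a b a' b'.
move=> /(pairing_fun_inj Gp (fkT a) (fkT b) (fkT a') (fkT b'))[ea eb].
by split; apply: ik => //; rewrite setUv; exact: mem_set.
Qed.

(** A point of an infinite type may encode any finite list of points: [proj j]
    reads off the [j]-th entry. *)
Lemma infinite_list_coding (T : choiceType) (e : nat -> T) : injective e ->
  exists proj : nat -> T -> T,
    forall (n : nat) (a : nat -> T), exists t, forall j, (j < n)%N ->
      proj j t = a j.
Proof.
move=> /infinite_square_injection[p pI].
pose fst' t := xget t [set a | exists b, t = p a b].
pose snd' t := xget t [set b | exists a, t = p a b].
have fstK a b : fst' (p a b) = a.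
  rewrite /fst'; have [c] := @xgetI _ (p a b) [set c | exists d, p a b = p c d]
    a (ex_intro _ b erefl).
  by move=> /pI[<-].
have sndK a b : snd' (p a b) = b.
  rewrite /snd'; have [c] := @xgetI _ (p a b) [set d | exists c, p a b = p c d]
    b (ex_intro _ a erefl).
  by move=> /pI[_ <-].
exists (fun j t => fst' (iter j snd' t)) => n.
elim: n => [|n IH] a; first by exists (e 0%N).
have [t tP] := IH (fun j => a j.+1); exists (p (a 0%N) t) => -[|j] jn.
  by rewrite /= fstK.
by rewrite iterSr sndK tP.
Qed.

(** * Indexing matrices by positive contractions *)

Section Indexing.
Variables (R : realType) (S : matOrdType R).
Hypothesis S_os : operator_system S.
Local Notation C := R[i].

Lemma mx11_const (A : 'M[S]_1) : const_mx (A ord0 ord0) = A.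
Proof. by apply/matrixP => i j; rewrite mxE !ord1. Qed.

(** The trivial operator system. *)
Lemma unit_eq0 : unit_elt S = 0 -> forall s : S, s = 0.
Proof.
move=> one0 s.
have t0 (a : 'M[C]_1) : tens1 S a = 0.
  by apply/matrixP => i j; rewrite !mxE one0 scaler0.
have H0 (H : 'M[S]_1) : starmx H = H -> H = 0.
  move=> /(order_unitP S_os)[r _ []]; rewrite t0 sub0r add0r => Hn Hp.
  exact: (mpos_proper S_os).
have [H [K [sH sK sE _]]] := cartesian (const_mx s : 'M_1).
have := congr1 (fun A : 'M[S]_1 => A ord0 ord0) sE.
by rewrite (H0 H sH) (H0 K sK) !mxE scaler0 addr0.
Qed.

(** The set of positive contractions. *)
Definition positive_ball : set S := [set y | pos_elt y /\ opnorm_elt y <= 1].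

Lemma positive_ballP (P : 'M[S]_1) : mpos P -> mpos (tens1 S 1%:M - P) ->
  positive_ball (P ord0 ord0).
Proof.
move=> Pp P1; split; first by rewrite /pos_elt mx11_const.
by rewrite /opnorm_elt mx11_const; apply: opnorm_le.
Qed.

Lemma positive_ball0 : positive_ball 0.
Proof.
have := @positive_ballP 0 (mpos0 S_os 1); rewrite subr0 mxE; apply.
exact: mpos_tens1_1.
Qed.

Lemma positive_ball_unit (r : R) : 0 <= r <= 1 ->
  positive_ball (r%:C *: unit_elt S).
Proof.
move=> /andP[r0 r1]; have := @positive_ballP (tens1 S r%:C%:M).
rewrite !mxE/= mulr1n; apply; first exact: mpos_tens1_real.
rewrite -tens1N -tens1D -[1%:M]/((1 : R)%:C%:M) -raddfB/= -rmorphB/=.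
by apply: mpos_tens1_real => //; rewrite subr_ge0.
Qed.

(** The positive contractions span the operator system; four of them and an
    integer factor suffice for each element. *)
Lemma positive_ball_span (s : S) : exists (N : nat) (p q p' q' : S),
  [/\ positive_ball p, positive_ball q, positive_ball p', positive_ball q' &
      s = N%:R *: ((p - q) + 'i *: (p' - q'))].
Proof.
have [H [K [sH sK sE _]]] := cartesian (const_mx s : 'M_1).
have [r r0 [rH rH']] := order_unitP S_os sH.
have [t t0 [tK tK']] := order_unitP S_os sK.
pose N := (Num.truncn (r + t)).+1.
have Nrt : r + t <= N%:R by apply/ltW; exact: truncnS_gt.
have N0 : (0 : R) < N%:R by rewrite ltr0n.
have half (G : 'M[S]_1) : mpos (tens1 S (N%:R : R)%:C%:M - G) ->
    mpos (tens1 S (N%:R : R)%:C%:M + G) ->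
    exists p q : S, [/\ positive_ball p, positive_ball q &
      G ord0 ord0 = N%:R *: (p - q)].
  move=> Gn Gp; pose c : R := (2 * N%:R)^-1.
  have c0 : 0 <= c by rewrite invr_ge0 mulr_ge0// ltW.
  pose P := scale_mx c%:C (tens1 S (N%:R : R)%:C%:M + G).
  pose Q := scale_mx c%:C (tens1 S (N%:R : R)%:C%:M - G).
  have cN : c * (N%:R + N%:R) = 1.
    by rewrite /c -mulr2n -[N%:R *+ 2]mulr_natl mulVf// gt_eqF// mulr_gt0.
  have Pp : mpos P by exact: mposZ.
  have Qp : mpos Q by exact: mposZ.
  have PQ : P + Q = tens1 S 1%:M.
    apply/matrixP => i j; rewrite !mxE -scalerDr addrACA subrr addr0 -scalerDl.
    rewrite scalerA; congr (_ *: _); rewrite !ord1 !eqxx !mulr1n.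
    by rewrite -rmorphD -rmorphM/= cN.
  exists (P ord0 ord0), (Q ord0 ord0); split.
  - by apply: positive_ballP => //; rewrite -PQ addrC addKr.
  - by apply: positive_ballP => //; rewrite -PQ addrK.
  have addBA (a b : S) : a + b + (b - a) = b + b.
    by rewrite [a + b]addrC addrACA subrr addr0.
  rewrite !mxE -scalerBr opprB addBA -mulr2n.
  have cN2 : N%:R * c%:C * 2%:R = 1 :> C.
    transitivity (c * (N%:R + N%:R))%:C; last by rewrite cN.
    by rewrite rmorphM rmorphD/= !rmorph_nat; ring.
  by rewrite -[G _ _ *+ 2]scaler_nat !scalerA cN2 scale1r.
have [||p [q [pb qb HE]]] := half H.
- by apply: mpos_le rH => //; lra.
- by apply: mpos_le rH' => //; lra.
have [||p' [q' [pb' qb' KE]]] := half K.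
- by apply: mpos_le tK => //; lra.
- by apply: mpos_le tK' => //; lra.
exists N, p, q, p', q'; split=> //.
have := congr1 (fun A : 'M[S]_1 => A ord0 ord0) sE.
rewrite !mxE HE KE => ->; rewrite [RHS]scalerDr; congr (_ + _).
by rewrite !scalerA mulrC.
Qed.

Variables (I : Type) (x : I -> S).
Hypothesis x_ball : range x = positive_ball.

(** An index set of the positive contractions is large enough to index all
    matrices: it is infinite unless the operator system is trivial, and a matrix
    is encoded by finitely many positive contractions and integers. *)
Lemma matrix_indexing k :
  exists h : I -> 'M[S]_k, forall M, exists i, h i = M.
Proof.
have x_surj p : positive_ball p -> exists i, x i = p.
  by rewrite -x_ball => -[i _ <-]; exists i.
have [one0|one_neq0] := pselect (unit_elt S = 0).
  have [i0 _] := x_surj 0 positive_ball0.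
  exists (fun=> 0) => M; exists i0; apply/matrixP => a b.
  by rewrite mxE [RHS]unit_eq0.
have /choice[e eP] (n : nat) : exists i : {classic I},
    x i = (n.+1%:R^-1 : R)%:C *: unit_elt S.
  apply: x_surj; apply: positive_ball_unit.
  by rewrite invr_ge0 ler0n invf_le1 ?ler1n ?ltr0n.
have e_inj : injective e.
  move=> m n emn; have := eP m; rewrite emn eP => /eqP.
  rewrite -subr_eq0 -scalerBl -rmorphB/= => /eqP e0.
  have [//|mn] := eqVneq m n; case: one_neq0.
  have d0 : n.+1%:R^-1 - m.+1%:R^-1 != 0 :> R.
    by rewrite subr_eq0 (inj_eq invr_inj) eqr_nat eqSS eq_sym.
  rewrite -[LHS]scale1r -(_ : (n.+1%:R^-1 - m.+1%:R^-1)^-1%:C *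
    (n.+1%:R^-1 - m.+1%:R^-1)%:C = 1); last by rewrite -rmorphM/= mulVf.
  by rewrite -scalerA e0 scaler0.
(* The integer factors are encoded by way of the sequence [e]. *)
have [proj projP] := infinite_list_coding e_inj.
pose idx i := xget 0%N [set n | e n = i].
have eK n : idx (e n) = n.
  by apply: e_inj; rewrite /idx; case: xgetP => // /(_ n) [].
pose decode t := (idx (proj 0%N t))%:R *:
  ((x (proj 1%N t) - x (proj 2%N t)) + 'i *: (x (proj 3%N t) - x (proj 4%N t))).
have decode_surj s : exists t, decode t = s.
  have [N [p [q [p' [q' [pb qb pb' qb' ->]]]]]] := positive_ball_span s.
  have [ip ipE] := x_surj _ pb; have [iq iqE] := x_surj _ qb.
  have [ip' ip'E] := x_surj _ pb'; have [iq' iq'E] := x_surj _ qb'.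
  have [t tP] := projP 5 (nth (e 0%N) [:: e N; ip; iq; ip'; iq']).
  by exists t; rewrite /decode !tP//= eK ipE iqE ip'E iq'E.
have /choice[c cP] := decode_surj.
exists (fun t => \matrix_(a, b) decode (proj (enum_rank (a, b)) t)) => M.
pose code m : {classic I} :=
  if (insub m : option 'I_#|{: 'I_k * 'I_k}|) is Some o
  then c (M (enum_val o).1 (enum_val o).2) else e 0%N.
have [t tP] := projP #|{: 'I_k * 'I_k}| code.
exists t; apply/matrixP => a b; rewrite mxE tP//.
by rewrite /code valK enum_rankK cP.
Qed.

End Indexing.

(** * Every operator system is a quotient of the universal coproduct *)

Section ChoiFamily.
Variables (R : realType) (S : matOrdType R).
Hypothesis S_os : operator_system S.

(** The positive matrices [P] of trace at most [1]: those for which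
    [e_ab (x) t |-> P_ab] extends to a unital completely positive map. *)
Definition trace_le1 k (P : 'M[S]_k) : Prop :=
  mpos P /\ pos_elt (unit_elt S - \sum_a P a a).

(** The defect [1 - tr P] of the trace is absorbed by the value at [0]. *)
Lemma choi_ucp k (P : 'M[S]_k.+1) : trace_le1 P ->
  exists f : {linear frakC R k.+1 -> S},
    [/\ f (unit_elt (frakC R k.+1)) = unit_elt S,
        completely_positive f & forall a b, f (coord_unit R a b) = P a b].
Proof.
move=> [Pp tP]; pose P0 := corner_mx k (unit_elt S - \sum_a P a a).
have P0p : mpos P0 by exact: mpos_corner.
have [f fE] := ex_linear (choi_map_linear P0 P).
exists f; split=> [|n A Ap|a b]; rewrite ?fE.
- by rewrite choi_map_unit big_split/= corner_trace subrK.
- rewrite (_ : map_mx f A = map_mx (choi_map P0 P) A); first exact: choi_map_cp.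
  by apply/matrixP => i j; rewrite !mxE fE.
- exact: choi_map_coord_unit.
Qed.

(** The diagonal entries of [y] are at most its norm. *)
Lemma trace_le1_scale k (y : 'M[S]_k.+1) : mpos y -> 0 < opnorm y ->
  trace_le1 (scale_mx (k.+1%:R * opnorm y)^-1%:C y).
Proof.
move=> yp r0; have [_ yr] := opnorm_pos S_os yp; set r := opnorm y in r0 yr *.
have kr0 : 0 < k.+1%:R * r by rewrite mulr_gt0// ltr0n.
have c0 : 0 <= (k.+1%:R * r)^-1 by rewrite invr_ge0 ltW.
split; first exact: mposZ.
have diag a : mpos (const_mx (r%:C *: unit_elt S - y a a) : 'M[S]_1).
  have := mpos_cong S_os (delta_mx a ord0 : 'M_(k.+1, 1)) yr.
  congr mpos; apply/matrixP => i j; rewrite !mxE !ord1.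
  rewrite (bigD1 a)//= (bigD1 a)//= !mxE !eqxx/= conjC1 mul1r scale1r mulr1n.
  rewrite !big1 ?addr0// => [b ba|b ba].
    by rewrite big1// => c _; rewrite !mxE (negPf ba) conjC0 mul0r scale0r.
  by rewrite !mxE (negPf ba)/= mulr0 scale0r.
rewrite /pos_elt; have := mposZ S_os c0 (@mpos_sum _ _ S_os _ _
  (index_enum 'I_k.+1) xpredT _ (fun a _ => diag a)).
congr mpos; apply/matrixP => i j; rewrite !mxE summxE.
under eq_bigr => a _ do rewrite mxE.
rewrite sumrB sumr_const card_ord scalerBr; congr (_ - _); last first.
  by rewrite scaler_sumr; apply: eq_bigr => a _; rewrite mxE.
have c1 : (k.+1%:R * r)^-1%:C * (k.+1%:R * r%:C) = 1 :> R[i].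
  transitivity ((k.+1%:R * r)^-1 * (k.+1%:R * r))%:C.
    by rewrite !rmorphM/= rmorph_nat.
  by rewrite mulVf// gt_eqF.
by rewrite -[(_ *: _) *+ _]scaler_nat !scalerA -mulrA c1 scale1r.
Qed.

End ChoiFamily.

Section ExactLifting.
Variables (R : realType) (V S : matOrdType R) (f : {linear V -> S}).
Hypotheses (V_os : operator_system V) (S_os : operator_system S).
Hypothesis f_ucp : unital_completely_positive f.
(** Every positive matrix lifts exactly, with no [eps] of room. *)
Hypothesis f_lift : forall n (y : 'M[S]_n), mpos y ->
  exists2 z : 'M[V]_n, mpos z & map_mx f z = y.

Lemma exact_lifting_quotient : complete_order_quotient_map f.
Proof.
have f_ball p : positive_ball p -> exists v, f v = p.
  move=> [/f_lift[z _ zE] _]; exists (z ord0 ord0).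
  by have := congr1 (fun M : 'M[S]_1 => M ord0 ord0) zE; rewrite !mxE.
split=> // [w|n Q e Qp e0].
  have [N [p [q [p' [q' [pb qb pb' qb' ->]]]]]] := positive_ball_span S_os w.
  have [vp <-] := f_ball p pb; have [vq <-] := f_ball q qb.
  have [vp' <-] := f_ball p' pb'; have [vq' <-] := f_ball q' qb'.
  exists (N%:R *: ((vp - vq) + 'i *: (vp' - vq'))).
  by rewrite linearZ linearD/= linearZ [f (vp - _)]linearB
    [f (vp' - _)]linearB.
by apply: f_lift; apply: mposD => //; apply: mpos_tens1_real => //; exact: ltW.
Qed.

Lemma exact_lifting_proximinal : completely_order_proximinal (kernel f).
Proof.
have [f1 f_cp] := f_ucp.
have f_tens1 n (a : 'M[R[i]]_n) : map_mx f (tens1 V a) = tens1 S a.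
  by apply/matrixP => i j; rewrite !mxE linearZ/= f1.
move=> n; apply/seteqP; split=> Q [y -> yk]; exists y => //; last first.
  move=> e e0; have [k kJ ykp] := yk; exists k => //.
  by apply: mposD => //; apply: mpos_tens1_real => //; exact: ltW.
have [|z zp zE] := @f_lift n (map_mx f y).
  apply: (mpos_archimedean S_os) => e e0; have [k kJ] := yk e e0.
  move=> /f_cp; congr mpos; rewrite !map_mxD f_tens1; congr (_ + _).
  rewrite (_ : map_mx f k = 0) ?addr0//; apply/matrixP => i j.
  by rewrite !mxE; exact/eqP/kJ.
exists (z - y); last by rewrite addrC subrK.
move=> i j; have := congr1 (fun M : 'M[S]_n => M i j) zE; rewrite !mxE => zij.
by rewrite -[_ \in _]/(f _ == 0) linearB/= zij subrr.
Qed.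

End ExactLifting.

(** The completely positive state [F |-> F(0)_00]. *)
Lemma frakC_state (R : realType) k : exists c : {scalar frakC R k.+1},
  c (unit_elt (frakC R k.+1)) = 1 /\
  forall n (A : 'M[frakC R k.+1]_n), mpos A -> psdform (fun i j => c (A i j)).
Proof.
have [|c cE] := @ex_scalar _ (frakC R k.+1)
    (fun F => fev (unit_interval0 R) F ord0 ord0).
  by move=> a F G; exact: fev_linear.
exists c; split=> [|n A /frakC_mpos/(_ (unit_interval0 R))].
  by rewrite cE fev_unit.
move=> /(psdform_comp (fun i : 'I_n => (i, ord0 : 'I_k.+1))).
by congr psdform; apply/funext => i; apply/funext => j; rewrite cE.
Qed.

Theorem theorem3p5 (R : realType) (S : matOrdType R) (I : Type)
    (Ik : nat -> Type) (x : I -> S) :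
  operator_system S ->
  (forall k, exists f : I -> Ik k, bijective f) ->
  range x = [set y : S | pos_elt y /\ opnorm_elt y <= 1] ->
  exists Phi : {linear frakC_coproduct R Ik -> S},
    [/\ complete_order_quotient_map Phi,
        completely_order_proximinal (kernel Phi) &
        forall (k : nat) (y : 'M[S]_k), mpos y ->
          exists2 z : 'M[frakC_coproduct R Ik]_k,
            mpos z /\ map_mx Phi z = y &
            opnorm z <= (k ^ 2)%:R * opnorm y].
Proof.
move=> S_os I_bij x_ball.
(* The copies of size [k.+1] are labelled by matrices in [M_(k.+1)(S)]. *)
have index_ex k : exists h : Ik k -> 'M[S]_k.+1, forall M, exists i, h i = M.
  have [h hP] := matrix_indexing S_os x_ball k.+1.
  have [f [g fK gK]] := I_bij k.
  exists (h \o g) => M; have [i iM] := hP M.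
  by exists (f i); rewrite /= fK.
pose h k := sval (cid (index_ex k)).
have hP k M : exists i, h k i = M by rewrite /h; case: cid.
pose L : choiceType := {classic {k : nat & Ik k}}.
pose V (l : L) : matOrdType R := frakC R (projT1 l).+1.
have V_os l : operator_system (V l) by exact: frakC_operator_system.
have [l0] : exists l0 : L, True.
  have [i _] : range x 0 by rewrite x_ball; exact: positive_ball0.
  by have [f _] := I_bij 0%N; exists (existT _ 0%N (f i)).
move=> _.
have chi_ex (l : L) := frakC_state R (projT1 l).
pose chi l := sval (cid (chi_ex l)).
have chi_unit l : chi l (unit_elt (V l)) = 1.
  by rewrite /chi; case: cid => ? [].
have chi_cp l n (A : 'M[V l]_n) : mpos A -> psdform (fun i j => chi l (A i j)).
  by rewrite /chi; case: cid => ? [? +]; exact.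
have C_os : operator_system (oplus1 V).
  exact: (oplus1_operator_system l0 V_os chi_unit chi_cp).
(* On the copy labelled [P], the map sends [e_ab (x) t] to [P_ab]; labels that
   do not define such a map are treated as [0]. *)
have f_ex (l : L) : exists f : {linear V l -> S},
    [/\ f (unit_elt (V l)) = unit_elt S, completely_positive f &
        trace_le1 (h (projT1 l) (projT2 l)) ->
        forall a b, f (coord_unit R a b) = h (projT1 l) (projT2 l) a b].
  have [P1|nP] := pselect (trace_le1 (h (projT1 l) (projT2 l))).
    by have [f [f1 fp fE]] := choi_ucp S_os P1; exists f.
  have [|f [f1 fp fE]] := @choi_ucp _ _ S_os (projT1 l) 0.
    split; first exact: mpos0.
    rewrite big1 => [|a _]; last by rewrite mxE.
    have [|+ _] := @positive_ball_unit _ _ S_os 1; first by rewrite ler01 lexx.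
    by rewrite subr0 scale1r.
  by exists f.
pose f l := sval (cid (f_ex l)).
have f_unit l : f l (unit_elt (V l)) = unit_elt S.
  by rewrite /f; case: cid => ? [].
have f_cp l : completely_positive (f l) by rewrite /f; case: cid => ? [].
have fE (l : L) : trace_le1 (h (projT1 l) (projT2 l)) ->
    forall a b, f l (coord_unit R a b) = h (projT1 l) (projT2 l) a b.
  by rewrite /f; case: cid => ? [].
have [Phi PhiE] := oplus1_universal f_unit.
have Phi_unit : Phi (unit_elt (oplus1 V)) = unit_elt S.
  by rewrite -(oplus1_inj_unit V l0) PhiE.
have Phi_cp : completely_positive Phi.
  apply: (oplus1_map_cp l0 V_os chi_unit chi_cp S_os) => l n A Ap.
  rewrite (_ : map_mx Phi _ = map_mx (f l) A); first exact: f_cp.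
  by apply/matrixP => i j; rewrite !mxE PhiE.
have lift k (y : 'M[S]_k) : mpos y -> exists2 z : 'M[oplus1 V]_k,
    mpos z /\ map_mx Phi z = y & opnorm z <= (k ^ 2)%:R * opnorm y.
  move=> yp; have [y0 yr] := opnorm_pos S_os yp.
  have [r0|r0] := eqVneq (opnorm y) 0.
    exists 0; last by rewrite r0 mulr0; exact: opnorm0_le.
    by rewrite map_mx0 (opnorm_eq0 S_os yp r0); split=> //; exact: mpos0.
  (* Here [y / (k |y|)] has trace at most [1]; it is the label of a copy, and
     [y] is the image of [k |y| (e_ab (x) t)_ab], of norm at most [k^2 |y|]. *)
  have {y0 r0} r0 : 0 < opnorm y by rewrite lt_def r0.
  case: k y yp yr r0 => [|k] y yp yr r0.
    exists 0; last by rewrite mul0r; exact: opnorm0_le.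
    by split; [exact: mpos0|apply/matrixP => -[]].
  have [i hi] := hP k (scale_mx (k.+1%:R * opnorm y)^-1%:C y).
  pose l : L := existT _ k i.
  have Pl : trace_le1 (h (projT1 l) (projT2 l)).
    by rewrite /= hi; exact: trace_le1_scale.
  pose c := k.+1%:R * opnorm y.
  have c0 : 0 < c by rewrite mulr_gt0// ltr0n.
  pose Z : 'M[V l]_k.+1 := coord_matrix R k.+1.
  pose z := scale_mx c%:C (map_mx (@oplus1_inj R L V l) Z).
  have Zp : mpos (map_mx (@oplus1_inj R L V l) Z).
    apply: (oplus1_inj_mpos l0 V_os chi_unit chi_cp).
    exact: (@coord_matrix_mpos R k.+1).
  have zp : mpos z by apply: mposZ => //; exact: ltW.
  exists z; first split=> //.
    apply/matrixP => a b; rewrite !mxE linearZ/= PhiE fE// hi mxE scalerA.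
    by rewrite -rmorphM mulfV ?gt_eqF// scale1r.
  rewrite (_ : (k.+1 ^ 2)%:R * _ = c * k.+1%:R); last first.
    by rewrite /c natrX; ring.
  apply: opnorm_le => //; first by rewrite mulr_ge0// ltW.
  have Zle : mpos (tens1 (V l) (k.+1%:R : R)%:C%:M - Z).
    exact: (@coord_matrix_le R k.+1).
  have := oplus1_inj_mpos l0 V_os chi_unit chi_cp Zle.
  move=> /(mposZ C_os (ltW c0)); congr mpos.
  rewrite map_mxB map_inj_tens1; apply/matrixP => a b.
  by rewrite /z !mxE scalerBr scalerA [c%:C * (_ *+ (a == b))]mulrnAr -rmorphM.
have Phi_lift n (y : 'M[S]_n) : mpos y ->
    exists2 z : 'M[oplus1 V]_n, mpos z & map_mx Phi z = y.
  by move=> /lift[z [zp zE] _]; exists z.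
exists Phi; split; last exact: lift.
  exact: (exact_lifting_quotient C_os S_os (conj Phi_unit Phi_cp) Phi_lift).
exact: (exact_lifting_proximinal C_os S_os (conj Phi_unit Phi_cp) Phi_lift).
Qed.
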